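(* Let $A$ be a prime dissipative Volterra operator with a rank one imaginary part in a separable Hilbert space $\mathcal{H}$, and let $A_I h=l(h,e)e$ for every $h\in\mathcal{H}$, where $l>0$, $\|e\|=1$. Then $A$ is unitarily equivalent to the operator in $l_2(\mathbb{N})$ determined by the semi-infinite dissipative Jacobi matrix $J$ with diagonal entries $b_1=il$, $b_k=0$ for $k\ge2$, and off-diagonal entries $$a_n=\frac{l}{\sqrt{(2n-1)(2n+1)}},\qquad n=1,2,\ldots,$$ that is, $$J=\begin{pmatrix} il & \frac{l}{\sqrt{1\cdot 3}} & 0 & 0 & \cdots\\ \frac{l}{\sqrt{1\cdot 3}} & 0 & \frac{l}{\sqrt{3\cdot 5}} & 0 & \cdots\\ 0 & \frac{l}{\sqrt{3\cdot 5}} & 0 & \frac{l}{\sqrt{5\cdot 7}} & \cdots\\ \vdots & \vdots & \ddots & \ddots & \ddots\end{pmatrix}.$$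
   Context: For a bounded operator $A$ in a Hilbert space put $A_I=\frac{A-A^*}{2i}$. $A$ is dissipative if $A_I\ge0$; it has a rank one imaginary part if $\operatorname{rank}A_I=1$; it is prime (completely non-self-adjoint) if there is no nonzero reducing subspace of $A$ on which $A$ is self-adjoint. A Volterra operator is a compact operator whose spectrum consists of the single point zero. The semi-infinite Jacobi matrix with diagonal entries $b_k$ and off-diagonal entries $a_k$ is the tri-diagonal matrix with $b_k$ in position $(k,k)$ and $a_k$ in positions $(k,k+1)$ and $(k+1,k)$; when its entries are uniformly bounded it determines a bounded operator in $l_2(\mathbb{N})$ by matrix multiplication. *)

(* Defs.v *)
From HB Require Import structures.
From mathcomp Require Import all_boot all_order all_algebra.
From mathcomp Require Import all_classical all_reals all_analysis.
From mathcomp Require Import complex ring lra.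

Set Implicit Arguments.
Unset Strict Implicit.
Unset Printing Implicit Defensive.

Import Order.TTheory GRing.Theory Num.Theory.
Import numFieldNormedType.Exports.

Local Open Scope classical_set_scope.
Local Open Scope ring_scope.
Local Open Scope complex_scope.

Local Notation Re := complex.Re.
Local Notation Im := complex.Im.

(* Inner products are linear in the first argument and conjugate-linear in the
   second one. A Hilbert space is a complete normed module over R[i] whose norm
   comes from an inner product. Norms take values in R[i]. *)

Definition inner_product_norm (R : realType) (H : completeNormedModType R[i])
    (dot : {dot H for Num.conj}) : Prop :=
  forall h, dot h h = `|h| ^+ 2.

Definition separable_space (T : topologicalType) : Prop :=
  exists2 D : set T, countable D & dense D.

Section Operators.
Context (R : realType) (H : completeNormedModType R[i]).
Implicit Types (A B : H -> H) (M : set H).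

Definition bounded_operator A : Prop :=
  exists c : R, forall h, `|A h| <= c%:C * `|h|.

Definition compact_operator A : Prop :=
  forall S : set H, bounded_set S -> precompact (A @` S).

Definition spectrum A : set R[i] :=
  [set z | ~ exists B : {linear H -> H}, bounded_operator B /\
             forall h, B (A h - z *: h) = h /\ A (B h) - z *: B h = h].

Definition volterra A : Prop :=
  compact_operator A /\ spectrum A = [set 0].

Definition closed_subspace M : Prop :=
  [/\ closed M, M 0 & forall (a : R[i]) x y, M x -> M y -> M (a *: x + y)].

Variable dot : {dot H for Num.conj}.

(* For a bounded linear A the vector selected by [get] exists and is unique by
   the Riesz representation theorem. *)
Definition adjoint A : H -> H :=
  fun y => get [set z | forall x, dot (A x) y = dot x z].

Definition imaginary_part A : H -> H :=
  fun h => (2 * 'i)^-1 *: (A h - adjoint A h).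

Definition dissipative A : Prop :=
  forall h, 0 <= dot (imaginary_part A h) h.

Definition rank_one B : Prop :=
  exists2 v : H, v != 0 & range B = [set c *: v | c in [set: R[i]]].

Definition orthogonal_complement M : set H :=
  [set x | forall y, M y -> dot x y = 0].

Definition invariant A M : Prop := forall x, M x -> M (A x).

Definition reducing A M : Prop :=
  [/\ closed_subspace M, invariant A M & invariant A (orthogonal_complement M)].

Definition self_adjoint_on A M : Prop :=
  forall x y, M x -> M y -> dot (A x) y = dot x (A y).

Definition prime_operator A : Prop :=
  forall M, reducing A M -> self_adjoint_on A M -> M = [set 0].

End Operators.

Definition unitarily_equivalent (R : realType) (U V : lmodType R[i])
    (dotU : {dot U for Num.conj}) (dotV : {dot V for Num.conj})
    (A : U -> U) (B : V -> V) : Prop :=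
  exists W : {linear U -> V},
    [/\ bijective W, isometry dotV dotU W & forall u, W (A u) = B (W u)].

(* Sequences are indexed from 0: the k-th coordinate of the mathematical
   sequence is the value at k.-1. *)

Definition complex_series (R : realType) (u : nat -> R[i]) : R[i] :=
  limn (series (fun k => Re (u k))) +i* limn (series (fun k => Im (u k))).

Definition sqnormc (R : realType) (z : R[i]) : R := Normc.normc z ^+ 2.

Definition square_summable (R : realType) : {pred (nat -> R[i])} :=
  [pred x | `[< cvgn (series (fun k => sqnormc (x k))) >]].
Arguments square_summable : clear implicits.

Section SquareSummable.
Context (R : realType).
Implicit Types (x y z : nat -> R[i]) (a : R[i]).

Lemma sqnormcE (z : R[i]) : sqnormc z = Re z ^+ 2 + Im z ^+ 2.
Proof.
by case: z => u v; rewrite /sqnormc /= sqr_sqrtr// addr_ge0 ?sqr_ge0.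
Qed.

Lemma sqnormc_ge0 (z : R[i]) : 0 <= sqnormc z.
Proof. exact: sqr_ge0. Qed.

Lemma sqnormcM (z w : R[i]) : sqnormc (z * w) = sqnormc z * sqnormc w.
Proof. by rewrite /sqnormc Normc.normcM exprMn. Qed.

Lemma sqnormc0 : sqnormc (0 : R[i]) = 0.
Proof. by rewrite /sqnormc Normc.normc0 expr0n. Qed.

Lemma ler_sqnormcD (z w : R[i]) :
  sqnormc (z + w) <= 2 * sqnormc z + 2 * sqnormc w.
Proof.
rewrite !sqnormcE; case: z w => [a b] [c d] /=.
have := sqr_ge0 (b - d); have := sqr_ge0 (a - c).
rewrite !sqrrB !sqrrD !mulr2n => ? ?; lra.
Qed.

Lemma square_summable_closed : submod_closed (square_summable R).
Proof.
split=> [|a x y /asboolP xs /asboolP ys]; apply/asboolP.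
  rewrite (_ : (fun _ => _) = (fun=> 0)).
    rewrite (_ : series _ = cst 0); first exact: is_cvg_cst.
    by apply/funext => n; rewrite /series /= big1.
  by apply/funext => k; rewrite sqnormc0.
pose v k : R := 2 * sqnormc a * sqnormc (x k) + 2 * sqnormc (y k).
apply: (@series_le_cvg _ _ v) => [k|k|k|].
- exact: sqnormc_ge0.
- exact: addr_ge0 (mulr_ge0 (mulr_ge0 (ler0n _ _) (sqnormc_ge0 _))
    (sqnormc_ge0 _)) (mulr_ge0 (ler0n _ _) (sqnormc_ge0 _)).
- have := ler_sqnormcD (a * x k) (y k).
  by rewrite sqnormcM mulrA.
- rewrite (_ : v = (2 * sqnormc a) *: (fun k => sqnormc (x k))
    + 2 *: (fun k => sqnormc (y k))) //.
  by apply: is_cvg_seriesD; exact: is_cvg_seriesZ.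
Qed.

HB.instance Definition _ := GRing.isSubmodClosed.Build R[i] (nat -> R[i])
  (square_summable R) square_summable_closed.

End SquareSummable.

Record ell2 (R : realType) := Ell2 {
  ell2_val :> nat -> R[i];
  ell2_valP : ell2_val \in square_summable R }.

HB.instance Definition _ (R : realType) := [isSub for @ell2_val R].
HB.instance Definition _ (R : realType) := [Choice of ell2 R by <:].
HB.instance Definition _ (R : realType) :=
  [SubChoice_isSubLmodule of ell2 R by <:].

Definition ell2_dot (R : realType) (x y : ell2 R) : R[i] :=
  complex_series (fun k => x k * (y k)^*).

Section Ell2Dot.
Context (R : realType).
Implicit Types (x y z : ell2 R) (a : R[i]).

Lemma ell2_is_cvg x : cvgn (series (fun k => sqnormc (x k))).
Proof. by have /asboolP := ell2_valP x. Qed.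

Lemma is_cvg_ell2_dot x y :
  cvgn (series (fun k => Re (x k * (y k)^*))) /\
  cvgn (series (fun k => Im (x k * (y k)^*))).
Proof.
have cv : cvgn (series (fun k => sqnormc (x k) + sqnormc (y k))).
  exact: is_cvg_seriesD (@ell2_is_cvg x) (@ell2_is_cvg y).
have le (u : nat -> R) : (forall k, `|u k| <= sqnormc (x k) + sqnormc (y k)) ->
    cvgn (series u).
  move=> uP; apply: (@normed_cvg _ R^o); apply: series_le_cvg cv => k.
  - exact: normr_ge0.
  - by rewrite addr_ge0 ?sqnormc_ge0.
  - exact: uP.
split; apply: le => k; rewrite !sqnormcE;
  case: (ell2_val x k) (ell2_val y k) => [a b] [c d] /=;
  have := (sqr_ge0 (a - c), sqr_ge0 (b - d), sqr_ge0 (a + c), sqr_ge0 (b + d));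
  have := (sqr_ge0 (a - d), sqr_ge0 (b - c), sqr_ge0 (a + d), sqr_ge0 (b + c));
  have := (sqr_ge0 a, sqr_ge0 b, sqr_ge0 c, sqr_ge0 d);
  rewrite !sqrrB !sqrrD !mulr2n ler_norml;
  move=> [[[? ?] ?] ?] [[[? ?] ?] ?] [[[? ?] ?] ?]; apply/andP; split; lra.
Qed.

Lemma lim_series_comb (p q : R) (u v w : nat -> R) :
  cvgn (series u) -> cvgn (series v) -> cvgn (series w) ->
  limn (series (fun k => p * u k + q * v k + w k)) =
  p * limn (series u) + q * limn (series v) + limn (series w).
Proof.
move=> cu cv cw.
have pu : cvgn (series (p *: u)) by exact: is_cvg_seriesZ.
have qv : cvgn (series (q *: v)) by exact: is_cvg_seriesZ.
have pq : cvgn (series (p *: u + q *: v)) by exact: is_cvg_seriesD.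
by rewrite (lim_seriesD pq cw) (lim_seriesD pu qv) !lim_seriesZ.
Qed.

Lemma ell2_dotP a x y z :
  ell2_dot (a *: x + y) z = a * ell2_dot x z + ell2_dot y z.
Proof.
have [xr xi] := is_cvg_ell2_dot x z; have [yr yi] := is_cvg_ell2_dot y z.
case: a => a b; rewrite /ell2_dot /complex_series.
transitivity (
  (a * limn (series (fun k => Re (x k * (z k)^*)))
   + (- b) * limn (series (fun k => Im (x k * (z k)^*)))
   + limn (series (fun k => Re (y k * (z k)^*)))) +i*
  (a * limn (series (fun k => Im (x k * (z k)^*)))
   + b * limn (series (fun k => Re (x k * (z k)^*)))
   + limn (series (fun k => Im (y k * (z k)^*))))); last first.
  by simpc.
rewrite -!lim_series_comb //.
congr (_ +i* _); congr (limn (series _)); apply/funext => k;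
  rewrite -[(ell2_val (_ + _)) k]/((a +i* b) * x k + y k);
  case: (ell2_val x k) (ell2_val y k) (ell2_val z k) => [? ?] [? ?] [? ?] /=;
  ring.
Qed.

Lemma ell2_dotC x y : ell2_dot x y = (ell2_dot y x)^*.
Proof.
have [_ yi] := is_cvg_ell2_dot y x.
rewrite /ell2_dot /complex_series -[RHS]/(_ +i* _); congr (_ +i* _).
  congr (limn (series _)); apply/funext => k.
  by case: (ell2_val x k) (ell2_val y k) => [? ?] [? ?] /=; ring.
rewrite -lim_seriesN //; congr (limn (series _)); apply/funext => k.
rewrite !fctE; by case: (ell2_val x k) (ell2_val y k) => [? ?] [? ?] /=; ring.
Qed.

Lemma ell2_dot_linear :
  bilinear_for *%R (Num.conj \; *%R) (@ell2_dot R).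
Proof.
split=> [z a x y|x a y z]; first exact: ell2_dotP.
by rewrite ell2_dotC ell2_dotP rmorphD rmorphM [ell2_dot x y]ell2_dotC
  [ell2_dot x z]ell2_dotC.
Qed.

Lemma ell2_dot_hermitian x y :
  ell2_dot x y = (-1) ^+ false * Num.conj (ell2_dot y x).
Proof. by rewrite expr0 mul1r; exact: ell2_dotC. Qed.

Lemma ell2_dot_gt0 x : x != 0 -> 0 < ell2_dot x x.
Proof.
move=> x0.
have [k xk] : exists k, x k != 0.
  apply/not_existsP => xz; move/negP: x0; apply; apply/eqP/val_inj/funext => k.
  by apply/eqP/negPn/negP; exact: xz.
have -> : ell2_dot x x = (limn (series (fun k => sqnormc (x k))))%:C.
  rewrite /ell2_dot /complex_series; congr (_ +i* _).
    congr (limn (series _)); apply/funext => j; rewrite sqnormcE.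
    by case: (ell2_val x j) => [? ?] /=; ring.
  rewrite (_ : series _ = cst 0) ?lim_cst//; apply/funext => n.
  rewrite /series /= big1 // => j _.
  by case: (ell2_val x j) => [? ?] /=; ring.
rewrite ltcR; apply: (@lt_le_trans _ _ (series (fun k => sqnormc (x k)) k.+1)).
  rewrite /series /= big_nat_recr //= ltr_wpDl ?sumr_ge0 // => [j _|].
    exact: sqr_ge0.
  rewrite lt_def sqr_ge0 andbT expf_eq0 /=.
  by apply: contra xk => /eqP/Normc.eq0_normc ->.
apply: nondecreasing_cvgn_le; last exact: ell2_is_cvg.
by apply/nondecreasing_seqP => n; rewrite seriesSr lerDl sqr_ge0.
Qed.

HB.instance Definition _ := bilinear_isBilinear.Build R[i] (ell2 R) (ell2 R)
  R[i] *%R (Num.conj \; *%R) (@ell2_dot R) ell2_dot_linear.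
HB.instance Definition _ := isHermitianSesquilinear.Build R[i] (ell2 R) false
  Num.conj (@ell2_dot R) ell2_dot_hermitian.
HB.instance Definition _ := isDotProduct.Build R[i] (ell2 R) (@ell2_dot R)
  ell2_dot_gt0.

End Ell2Dot.

(* The entries b_1, b_2, ... and a_1, a_2, ... are passed as functions used at
   arguments >= 1, while rows and columns are numbered from 0. *)
Definition jacobi_matrix (R : realType) (b a : nat -> R[i]) : nat -> nat -> R[i] :=
  fun i j => if i == j then b i.+1
             else if j == i.+1 then a i.+1
             else if i == j.+1 then a j.+1
             else 0.

Definition determined_by (R : realType) (M : nat -> nat -> R[i])
    (T : ell2 R -> ell2 R) : Prop :=
  forall x i, T x i = complex_series (fun j => M i j * x j).

Definition volterra_diagonal (R : realType) (l : R) (k : nat) : R[i] :=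
  if k == 1%N then 'i * l%:C else 0.

Definition volterra_offdiagonal (R : realType) (l : R) (n : nat) : R[i] :=
  (l / Num.sqrt ((2 * n%:R - 1) * (2 * n%:R + 1)))%:C.

(* Main.v *)
(* Write c = 2il.  On the disc of radius rho the resolvent
   R(w) = (1 - wA)^-1 is bounded, so rho^n A^n -> 0 for every rho.  The
   function S(w) = 1 + c w (R(w)e, e) is then entire and zero free, with
   |S(w)|^2 = 1 - 4 l Im w |R(w)e|^2 and S'/S = c K, where
   K(w) = (R(w)e, R(w^* )e) = sum_n G_n w^n and
   G_n = sum_k (A^k e, A^(n-k) e) is real.  Along a ray, ln |S(rz)|^2 =
   -4 l sum_n G_n Im (z^(n+1)) r^(n+1) / (n+1) is nonpositive in the upper
   half plane; as |sin mt| <= m |sin t|, comparing Fourier coefficients gives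
   |G_n| r^n <= (n+1)^2 for all r, that is S(w) = exp(c w).

   The equations G_n = 0, n > 0, determine all the products
   (A^k e, A^j e), which are those of the functions (cx)^k / k! and
   (cx)^j / j! in L^2(0,1): on the closed span of the A^k e, A is
   f |-> c int_0^x f.  In the orthonormal system i^n sqrt(2n+1) P_n of
   shifted Legendre polynomials this operator has matrix J, because
   P_(n+2) - P_n is (4n+6) times a primitive of P_(n+1).  The orthogonal
   complement of this system reduces A to a self-adjoint operator, hence is
   zero. *)
From HB Require Import structures.
Require Import Defs.
From mathcomp Require Import all_boot all_order all_algebra.
From mathcomp Require Import all_classical all_reals all_analysis.
From mathcomp Require Import complex.
From mathcomp Require Import cyclic separable cyclotomic zify ring lra.
Set Implicit Arguments.
Unset Strict Implicit.
Unset Printing Implicit Defensive.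
Import Order.TTheory GRing.Theory Num.Theory.
Import numFieldNormedType.Exports.
Local Open Scope classical_set_scope.
Local Open Scope ring_scope.
Local Open Scope complex_scope.
Local Notation Re := complex.Re.
Local Notation Im := complex.Im.
Local Notation nc := Normc.normc.

(** * Complex numbers, roots of unity and discrete sine coefficients *)

Section ComplexNumbers.
Context (R : realType).
Implicit Types (z w : R[i]) (x y : R).

Lemma Re_add z w : Re (z + w) = Re z + Re w. Proof. by case: z w => [? ?] [? ?]. Qed.
Lemma Im_add z w : Im (z + w) = Im z + Im w. Proof. by case: z w => [? ?] [? ?]. Qed.
Lemma Re_opp z : Re (- z) = - Re z. Proof. by case: z. Qed.
Lemma Im_opp z : Im (- z) = - Im z. Proof. by case: z. Qed.
Lemma Re_mul z w : Re (z * w) = Re z * Re w - Im z * Im w.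
Proof. by case: z w => [? ?] [? ?]. Qed.
Lemma Im_mul z w : Im (z * w) = Re z * Im w + Im z * Re w.
Proof. by case: z w => [? ?] [? ?]. Qed.
Lemma Re_conjc z : Re (Num.conj z) = Re z. Proof. by case: z. Qed.
Lemma Im_conjc z : Im (Num.conj z) = - Im z. Proof. by case: z. Qed.

Lemma Re_sum I (r : seq I) P (F : I -> R[i]) :
  Re (\sum_(i <- r | P i) F i) = \sum_(i <- r | P i) Re (F i).
Proof. by elim/big_rec2: _ => // i x y _ <-; rewrite Re_add. Qed.
Lemma Im_sum I (r : seq I) P (F : I -> R[i]) :
  Im (\sum_(i <- r | P i) F i) = \sum_(i <- r | P i) Im (F i).
Proof. by elim/big_rec2: _ => // i x y _ <-; rewrite Im_add. Qed.

Lemma Re_nat n : Re (n%:R : R[i]) = n%:R.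
Proof. by elim: n => // n IH; rewrite -!natr1 Re_add IH. Qed.

Lemma complexP z w : Re z = Re w -> Im z = Im w -> z = w.
Proof. by case: z w => [? ?] [? ?] /= -> ->. Qed.

Lemma conj_real x : Num.conj x%:C = x%:C.
Proof. by apply: complexP; rewrite ?Re_conjc ?Im_conjc /= ?oppr0. Qed.

Lemma normc_ge0 z : 0 <= nc z.
Proof. by case: z => ? ? /=; exact: sqrtr_ge0. Qed.

Lemma sqr_normcE z : nc z ^+ 2 = Re z ^+ 2 + Im z ^+ 2.
Proof. exact: sqnormcE. Qed.

Lemma normr_complex z : `|z| = (nc z)%:C.
Proof. by rewrite normc_def; case: z. Qed.

Lemma normc_conj z : nc (Num.conj z) = nc z.
Proof. by case: z => ? ? /=; rewrite sqrrN. Qed.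

Lemma mulc_conj z : z * Num.conj z = (nc z ^+ 2)%:C.
Proof.
rewrite sqr_normcE; apply: complexP; rewrite ?Re_mul ?Im_mul Re_conjc Im_conjc /=; ring.
Qed.

Lemma normc_real x : nc x%:C = `|x|.
Proof. by rewrite /= expr0n addr0 sqrtr_sqr. Qed.

Lemma normc_imaginary : nc ('i : R[i])%R = 1.
Proof. by rewrite /= expr0n expr1n add0r sqrtr1. Qed.

Lemma normcX z n : nc (z ^+ n) = nc z ^+ n.
Proof.
elim: n => [|n IH]; first by rewrite !expr0 Normc.normc1.
by rewrite !exprS Normc.normcM IH.
Qed.

Lemma normc_Re z : `|Re z| <= nc z.
Proof.
by rewrite -ler_sqr ?nnegrE ?normc_ge0// sqr_normcE real_normK ?num_real// lerDl sqr_ge0.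
Qed.

Lemma normc_Im z : `|Im z| <= nc z.
Proof.
by rewrite -ler_sqr ?nnegrE ?normc_ge0// sqr_normcE real_normK ?num_real// lerDr sqr_ge0.
Qed.

Lemma normc_le_ReIm z : nc z <= `|Re z| + `|Im z|.
Proof.
rewrite -ler_sqr ?nnegrE ?normc_ge0 ?addr_ge0// sqr_normcE sqrrD.
by rewrite !real_normK ?num_real// addrAC lerDl mulrn_wge0// mulr_ge0.
Qed.

Lemma normc_sum I (r : seq I) P (F : I -> R[i]) :
  nc (\sum_(i <- r | P i) F i) <= \sum_(i <- r | P i) nc (F i).
Proof.
elim/big_ind2: _ => [|z x w y zx wy|//]; first by rewrite Normc.normc0.
by rewrite (le_trans (le_normcD _ _))// lerD.
Qed.

Lemma sqr_normcD (u v : R[i]) :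
  nc (u + v) ^+ 2 = nc u ^+ 2 + 2 * Re (Num.conj u * v) + nc v ^+ 2.
Proof.
rewrite !sqr_normcE !(Re_add, Im_add, Re_mul, Im_mul, Re_conjc, Im_conjc); ring.
Qed.

(** [X^n - 1] is separable in characteristic zero, so it has n distinct roots, and n distinct n-th
    roots of unity include a primitive one. *)
Lemma primitive_root_exists n : (0 < n)%N -> exists z : R[i], n.-primitive_root z.
Proof.
pose p : {poly R[i]} := 'X^n - 1; have [r Dp] := closed_field_poly_normal p.
move=> n_gt0; rewrite (monicP _) ?monicXnsubC // scale1r in Dp.
have rn1: all n.-unity_root r by apply/allP=> z; rewrite -root_prod_XsubC -Dp.
have sz_r: (n < (size r).+1)%N by rewrite -(size_prod_XsubC r id) -Dp size_XnsubC.
have [|z] := hasP (has_prim_root n_gt0 rn1 _ sz_r); last by exists z.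
by rewrite -separable_prod_XsubC -Dp separable_Xn_sub_1 // pnatr_eq0 -lt0n.
Qed.

Lemma sum_primitive_root n z t : n.-primitive_root z ->
  \sum_(j < n) (z ^+ j) ^+ t = if (n %| t)%N then n%:R else 0.
Proof.
move=> pz; have -> : \sum_(j < n) (z ^+ j) ^+ t = \sum_(j < n) (z ^+ t) ^+ j.
  by apply: eq_bigr => j _; rewrite -!exprM mulnC.
rewrite (prim_order_dvd pz).
case: eqP => [->|zt].
  by rewrite (eq_bigr (fun=> 1)) ?sumr_const ?card_ord// => j _; rewrite expr1n.
have := subrX1 (z ^+ t) n; rewrite -exprM mulnC exprM (prim_expr_order pz) expr1n.
by rewrite subrr => /esym/eqP; rewrite mulf_eq0 subr_eq0 => /orP[/eqP|/eqP].
Qed.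

Lemma normc_primitive_root n z : n.-primitive_root z -> nc z = 1.
Proof.
move=> pz; have n0 := prim_order_gt0 pz.
have /eqP : nc z ^+ n = 1 by rewrite -normcX (prim_expr_order pz) Normc.normc1.
by rewrite pexprn_eq1 ?normc_ge0// eqn0Ngt n0 => /eqP.
Qed.

(** This is |sin nt| <= n |sin t|, by induction through the addition formula. *)
Lemma Im_exp_le z n : nc z = 1 -> `|Im (z ^+ n)| <= n%:R * `|Im z|.
Proof.
move=> z1; elim: n => [|n IH]; first by rewrite expr0 /= normr0 mul0r.
rewrite exprS Im_mul (le_trans (ler_normD _ _))// mulrS mulrDl mul1r addrC !normrM.
rewrite lerD//.
  rewrite ler_piMr// (le_trans (normc_Re _))// normcX z1 expr1n//.
by rewrite (le_trans _ IH)// ler_piMl// (le_trans (normc_Re _))// z1.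
Qed.

(** Discrete orthogonality of sines: the product is half a difference of cosines of frequencies a -
    b and a + b. The bound a + b < n excludes aliasing, as no such frequency except zero is
    divisible by n. *)
Lemma sum_Im_primitive_root n z a b : n.-primitive_root z ->
  (0 < a)%N -> (0 < b)%N -> (a + b < n)%N ->
  \sum_(j < n) Im ((z ^+ j) ^+ a) * Im ((z ^+ j) ^+ b) =
  if a == b then n%:R / 2 else 0.
Proof.
move=> pz a0 b0 abn; have z1 := normc_primitive_root pz.
have bn : (b < n)%N by rewrite (leq_ltn_trans _ abn)// leq_addl.
have an : (a < n)%N by rewrite (leq_ltn_trans _ abn)// leq_addr.
have E (j : 'I_n) : Im ((z ^+ j) ^+ a) * Im ((z ^+ j) ^+ b) =
    2^-1 * Re ((z ^+ j) ^+ (a + (n - b)) - (z ^+ j) ^+ (a + b)).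
  (* The exponent n - b stands for -b, because conjugation inverts a root of unity. *)
  have -> : (z ^+ j) ^+ (a + (n - b)) = (z ^+ j) ^+ a * Num.conj ((z ^+ j) ^+ b).
    have zb0 : (z ^+ j) ^+ b != 0.
      rewrite !expf_neq0//; apply/eqP => z0.
      by move: z1; rewrite z0 Normc.normc0 => /esym/eqP; rewrite oner_eq0.
    apply: (mulIf zb0); rewrite exprD -!mulrA; congr (_ * _).
    rewrite -exprD subnK ?(ltnW bn)// [RHS]mulrC mulc_conj !normcX z1 !expr1n.
    by rewrite -exprM mulnC exprM (prim_expr_order pz) expr1n.
  rewrite exprD Re_add Re_opp !Re_mul Re_conjc Im_conjc; by field.
rewrite (eq_bigr _ (fun j _ => E j)) -mulr_sumr -Re_sum sumrB !(sum_primitive_root _ pz).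
have -> : (n %| a + b)%N = false by rewrite gtnNdvd// addn_gt0 a0.
have -> : (n %| a + (n - b))%N = (a == b).
  have [ab|ba|->] := ltngtP a b; last by rewrite subnKC ?dvdnn// ltnW.
    by rewrite gtnNdvd ?addn_gt0 ?a0// addnBA ?(ltnW bn)// ltn_subLR ?ltn_add2r// ltnW// ltn_addl.
  have -> : (a + (n - b) = n + (a - b))%N.
    by rewrite addnBA ?(ltnW bn)// addnC addnBA// ltnW.
  by rewrite dvdn_addr// gtnNdvd ?subn_gt0// (leq_ltn_trans _ an)// leq_subr.
by case: (a == b); rewrite subr0 /= ?mulr0// Re_nat mulrC.
Qed.

(* Testing against the functions [m Im z +- Im z^m], which have the sign of
   [Im z] on the unit circle, replaces integration against
   [m sin t +- sin (m t)] by an average over roots of unity. *)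
Lemma sine_coef_le (M m : nat) (d : nat -> R) (eps : R) : (m.+1 < M)%N ->
  (forall z, nc z = 1 -> 0 <= Im z ->
    - eps <= \sum_(n < M) d n * Im (z ^+ n.+1)) -> 0 <= eps -> (0 < m)%N ->
  `|d m| <= m.+1%:R * (d 0%N + 4 * eps).
Proof.
move=> mM dP eps0 m0; pose L z := \sum_(n < M) d n * Im (z ^+ n.+1).
(* All exponents that occur are at most M, so any two of them add up to less than [N]. *)
pose N := (M + M).+1.
have [w pw] := @primitive_root_exists N (ltn0Sn _).
have w1 := normc_primitive_root pw.
(* For s = 1 and s = -1 the weight (m+1) Im z + s Im z^(m+1) has the sign of Im z and modulus at
   most 2(m+1), so each point contributes at least -eps times 2(m+1). *)
have test (s : R) : s ^+ 2 = 1 -> - eps * (2 * m.+1%:R) * N%:R <=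
    (m.+1%:R * d 0%N + s * d m) * (N%:R / 2).
  move=> s1.
  have coef k : (k < M)%N -> \sum_(j < N) L (w ^+ j) * Im ((w ^+ j) ^+ k.+1) = d k * (N%:R / 2).
    move=> kM.
    under eq_bigr do rewrite mulr_suml.
    rewrite exchange_big /= (bigD1 (Ordinal kM)) //= [X in _ + X]big1 ?addr0.
      under eq_bigr do rewrite -mulrA.
      by rewrite -mulr_sumr (sum_Im_primitive_root pw)// ?eqxx// -/N /N ltnS leq_add.
    move=> i ik; under eq_bigr do rewrite -mulrA.
    rewrite -mulr_sumr (sum_Im_primitive_root pw)//; last by rewrite -/N /N ltnS leq_add.
    by rewrite eqSS -val_eqE /= in ik *; rewrite (negPf ik) mulr0.
  have -> : (m.+1%:R * d 0%N + s * d m) * (N%:R / 2) =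
     \sum_(j < N) L (w ^+ j) * (m.+1%:R * Im ((w ^+ j) ^+ 1) + s * Im ((w ^+ j) ^+ m.+1)).
    under eq_bigr do rewrite mulrDr !(mulrCA (L _)).
    by rewrite big_split /= -!mulr_sumr !coef ?(ltnW mM)// ?(leq_trans _ mM)// mulrDl !mulrA.
  have -> : - eps * (2 * m.+1%:R) * N%:R = \sum_(j < N) (- eps * (2 * m.+1%:R)).
    by rewrite sumr_const card_ord mulr_natr.
  apply: ler_sum => j _; set z := w ^+ j.
  have z1 : nc z = 1 by rewrite normcX w1 expr1n.
  have s_norm : `|s| = 1.
    have /eqP : `|s| ^+ 2 = 1 by rewrite real_normK ?num_real.
    by rewrite pexprn_eq1//= => /eqP.
  have B := Im_exp_le m.+1 z1.
  rewrite expr1; set T := m.+1%:R * Im z + s * Im (z ^+ m.+1).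
  have sB : `|s * Im (z ^+ m.+1)| <= m.+1%:R * `|Im z| by rewrite normrM s_norm mul1r.
  have zle : `|Im z| <= 1 by rewrite -z1 normc_Im.
  have m1 : 0 <= m.+1%:R :> R by [].
  have mz : m.+1%:R * `|Im z| <= m.+1%:R by rewrite ler_piMr.
  have Tle : `|T| <= 2 * m.+1%:R.
    rewrite (le_trans (ler_normD _ _))// normrM normr_nat; lra.
  have [z0|z0] := leP 0 (Im z).
    have T0 : 0 <= T.
      move: sB; rewrite ler_norml (ger0_norm z0) /T => /andP[]; lra.
    have := dP z z1 z0; rewrite -/(L z) => Lz.
    rewrite (ger0_norm T0) in Tle.
    apply: le_trans (_ : - eps * T <= _); last by rewrite ler_wpM2r.
    by rewrite !mulNr lerN2 ler_wpM2l.
  have T0 : T <= 0.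
    move: sB; rewrite ler_norml (ltr0_norm z0) /T => /andP[]; lra.
  (* [L] is odd under conjugation: the hypothesis applies at the conjugate point, and both factors
     of [L z * T] change sign. *)
  have Lz : - eps <= - L z.
    have -> : - L z = L (Num.conj z).
      rewrite /L -sumrN; apply: eq_bigr => n _.
      by rewrite -rmorphXn Im_conjc mulrN.
    by apply: dP; rewrite ?normc_conj// Im_conjc oppr_ge0 ltW.
  rewrite (ler0_norm T0) in Tle.
  rewrite -[L z * T]mulrNN; apply: le_trans (_ : - eps * - T <= _).
    by rewrite !mulNr lerN2 ler_wpM2l.
  by rewrite ler_wpM2r ?oppr_ge0.
have N0 : 0 < N%:R :> R by rewrite ltr0n.
have half (x y : R) : x * N%:R <= y * (N%:R / 2) -> 2 * x <= y.
  by rewrite (_ : y * _ = y / 2 * N%:R) ?ler_pM2r//; [lra|ring].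
have m1 : 0 <= m.+1%:R :> R by [].
have h1 := half _ _ (test 1 (expr1n _ _)).
have sq1 : (-1) ^+ 2 = 1 :> R by rewrite sqrrN expr1n.
have h2 := half _ _ (test (-1) sq1).
rewrite ler_norml; apply/andP; split; lra.
Qed.
End ComplexNumbers.

(** * The norm as a real number *)

Definition rnorm (R : realType) (H : completeNormedModType R[i]) (x : H) : R :=
  Re `|x|.

Section Norm.
Context (R : realType) (H : completeNormedModType R[i]).
Implicit Types (x y : H) (a : R[i]).

Lemma normr_rnorm x : `|x| = (rnorm x)%:C.
Proof.
apply: complexP => //=; have := normr_ge0 x.
by rewrite lecE => /andP[/eqP -> _].
Qed.

Lemma rnorm_ge0 x : 0 <= rnorm x.
Proof. by rewrite -ler0c -normr_rnorm normr_ge0. Qed.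

Lemma ler_rnormD x y : rnorm (x + y) <= rnorm x + rnorm y.
Proof. by rewrite -lecR rmorphD /= -!normr_rnorm ler_normD. Qed.

Lemma rnormZ a x : rnorm (a *: x) = nc a * rnorm x.
Proof.
by apply: complexI; rewrite rmorphM /= -!normr_rnorm normrZ normr_complex.
Qed.

Lemma rnormN x : rnorm (- x) = rnorm x.
Proof. by rewrite /rnorm normrN. Qed.

Lemma rnorm0 : rnorm (0 : H) = 0.
Proof. by rewrite /rnorm normr0. Qed.

Lemma rnorm_eq0 x : rnorm x = 0 -> x = 0.
Proof. by move=> x0; apply/eqP; rewrite -normr_eq0 normr_rnorm x0. Qed.

Lemma ler_rnormB x y : rnorm (x - y) <= rnorm x + rnorm y.
Proof. by rewrite (le_trans (ler_rnormD _ _))// rnormN. Qed.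

Lemma ler_rnorm_sum I (r : seq I) (P : pred I) (F : I -> H) :
  rnorm (\sum_(i <- r | P i) F i) <= \sum_(i <- r | P i) rnorm (F i).
Proof.
elim/big_ind2: _ => [|z x w y zx wy|//]; first by rewrite rnorm0.
by rewrite (le_trans (ler_rnormD _ _))// lerD.
Qed.

Lemma bounded_operatorP (B : H -> H) : bounded_operator B ->
  exists2 c : R, 0 <= c & forall x, rnorm (B x) <= c * rnorm x.
Proof.
move=> [c Bc]; exists `|c| => // x.
apply: (@le_trans _ _ (c * rnorm x)); last by rewrite ler_wpM2r ?rnorm_ge0// ler_norm.
by have := Bc x; rewrite !normr_rnorm -rmorphM lecR.
Qed.

End Norm.

(** * Inner product and Cauchy-Schwarz inequality *)

Section InnerProduct.
Context (R : realType) (H : completeNormedModType R[i]).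
Context (dot : {dot H for Num.conj}).
Implicit Types (x y z : H) (a : R[i]).

Lemma dotDl x y z : dot (x + y) z = dot x z + dot y z.
Proof. exact: linearDl. Qed.
Lemma dotBl x y z : dot (x - y) z = dot x z - dot y z.
Proof. exact: linearBl. Qed.
Lemma dotZl a x z : dot (a *: x) z = a * dot x z.
Proof. exact: linearZl_LR. Qed.
Lemma dotDr x y z : dot z (x + y) = dot z x + dot z y.
Proof. exact: linearDr. Qed.
Lemma dotBr x y z : dot z (x - y) = dot z x - dot z y.
Proof. exact: linearBr. Qed.
Lemma dotZr a x z : dot z (a *: x) = Num.conj a * dot z x.
Proof. exact: linearZr_LR. Qed.
Lemma dot0l z : dot 0 z = 0. Proof. exact: linear0l. Qed.
Lemma dot0r z : dot z 0 = 0. Proof. exact: linear0r. Qed.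
Lemma dot_suml I (r : seq I) (P : pred I) (F : I -> H) z :
  dot (\sum_(i <- r | P i) F i) z = \sum_(i <- r | P i) dot (F i) z.
Proof. exact: linear_sumlz. Qed.
Lemma dot_sumr I (r : seq I) (P : pred I) (F : I -> H) z :
  dot z (\sum_(i <- r | P i) F i) = \sum_(i <- r | P i) dot z (F i).
Proof. exact: linear_sumr. Qed.
Lemma dotC x y : dot x y = Num.conj (dot y x).
Proof. by have := hermC dot x y; rewrite expr0 mul1r. Qed.

Hypothesis dot_norm : inner_product_norm dot.

Lemma dot_rnorm x : dot x x = (rnorm x ^+ 2)%:C.
Proof. by rewrite dot_norm normr_rnorm rmorphXn. Qed.

(** With b = |y|^2, the vector b x - (x,y) y has squared norm b (|x|^2 |y|^2 - |(x,y)|^2), which is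
    nonnegative. *)
Lemma normc_dot x y : nc (dot x y) <= rnorm x * rnorm y.
Proof.
rewrite -ler_sqr ?nnegrE ?mulr_ge0 ?rnorm_ge0 ?normc_ge0// exprMn -lecR.
have -> : (rnorm x ^+ 2 * rnorm y ^+ 2)%:C = dot x x * dot y y.
  by rewrite !dot_rnorm -rmorphM.
have [y0|y0] := eqVneq (rnorm y) 0.
  by rewrite (rnorm_eq0 y0) !dot0r Normc.normc0 expr0n mulr0.
pose b : R := rnorm y ^+ 2; have b0 : 0 < b by rewrite exprn_gt0// lt_def y0 rnorm_ge0.
pose u := b%:C *: x - dot x y *: y.
have : 0 <= dot u u by rewrite dot_rnorm ler0c sqr_ge0.
have -> : dot u u = b%:C * (b%:C * dot x x - (nc (dot x y) ^+ 2)%:C).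
  rewrite /u dotBl !dotBr !dotZl !dotZr (dot_rnorm y) -/b (dotC y x) conj_real.
  by rewrite -mulc_conj; ring.
by rewrite pmulr_rge0 ?ltcR// subr_ge0 mulrC (dot_rnorm y).
Qed.

End InnerProduct.

(** * The resolvent (1 - wA)^-1 and its local uniform bounds *)

Section Resolvent.
Context (R : realType) (H : completeNormedModType R[i]).
Context (A : {linear H -> H}).

(** For w nonzero, 1 - wA = -w (A - w^-1) and w^-1 is not in the spectrum; for w = 0 the inverse is
    the identity. *)
Lemma resolvent_exists : bounded_operator A -> spectrum A = [set 0] ->
  exists B : R[i] -> {linear H -> H}, forall w,
    [/\ exists2 c : R, 0 <= c & forall x, rnorm (B w x) <= c * rnorm x,
        forall x, B w (x - w *: A x) = x & forall x, B w x - w *: A (B w x) = x].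
Proof.
move=> Ab sA; suff /choice[f fP] : forall w, exists Bw : {linear H -> H},
    [/\ exists2 c : R, 0 <= c & forall x, rnorm (Bw x) <= c * rnorm x,
        forall x, Bw (x - w *: A x) = x & forall x, Bw x - w *: A (Bw x) = x].
  by exists f.
move=> w.
have [->|w0] := eqVneq w 0.
  exists idfun; split=> [|x|x] /=; rewrite ?scale0r ?subr0//.
  by exists 1 => // x; rewrite mul1r.
have : ~ spectrum A w^-1 by rewrite sA => /eqP; rewrite invr_eq0 (negPf w0).
move/contrapT => [B [/bounded_operatorP[c c0 Bc] Binv]].
exists ((- w^-1) \*: B : {linear H -> H}); split => [|x|x] /=.
- exists (nc (- w^-1) * c) => [|x]; first by rewrite mulr_ge0 ?normc_ge0.
  by rewrite rnormZ -mulrA ler_wpM2l ?normc_ge0.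
- rewrite -linearZ_LR scalerBr scalerA mulNr mulVf// scaleN1r opprK.
  by rewrite scaleNr addrC (Binv x).1.
- rewrite (linearZ_LR A) scalerA mulrN divff// scaleN1r opprK scaleNr addrC.
  exact: (Binv x).2.
Qed.

Context (a : R) (a0 : 0 <= a) (Aa : forall x, rnorm (A x) <= a * rnorm x).
Context (B : R[i] -> {linear H -> H}).
Hypothesis BK : forall w x, B w (x - w *: A x) = x.
Hypothesis KB : forall w x, B w x - w *: A (B w x) = x.
Hypothesis Bb : forall w, exists2 c : R, 0 <= c & forall x, rnorm (B w x) <= c * rnorm x.

Lemma iter_scale n b (x : H) : iter n A (b *: x) = b *: iter n A x.
Proof. by elim: n => //= n ->; rewrite linearZ_LR. Qed.

Lemma resolventE w x : B w x = x + w *: A (B w x).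
Proof. by rewrite -{2}(KB w x) subrK. Qed.

Lemma resolvent_comm w x : B w (A x) = A (B w x).
Proof. by rewrite -[RHS](BK w) -linearZ_LR -linearB KB. Qed.

(** Resolvent identity: insert (1 - vA) - (1 - wA) = (w - v) A between [B w] and [B v]. *)
Lemma resolventB w v x : B w x - B v x = (w - v) *: B w (A (B v x)).
Proof.
rewrite -{1}(KB v x) -[X in _ - X](BK w) -linearB -(linearZ_LR (B w)). congr (B w _).
by rewrite opprB addrC addrA subrK scalerBl.
Qed.

(** A bound at one point persists, doubled, in a neighbourhood; compactness of a square containing
    the disc makes it uniform. *)
Lemma resolvent_unif (r : R) : exists2 C : R, 0 <= C &
  forall w, nc w <= r -> forall x, rnorm (B w x) <= C * rnorm x.
Proof.
pose K : set (R * R) := `[-r, r]%classic `*` `[-r, r]%classic.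
have Kc : compact K by apply: compact_setX; exact: segment_compact.
pose P (C : R) (p : R * R) := forall x, rnorm (B (p.1 +i* p.2) x) <= C * rnorm x.
move/compact_near_coveringP : Kc => Kc.
have [p Kp|C [_ CP]] := Kc R (pinfty_nbhs R) P _.
  have [c c0 Bc] := Bb (p.1 +i* p.2).
  (* Within [d] in each coordinate |w - w'| <= 2d, so c |w - w'| a <= 1/2 and the perturbation term
     is absorbed on the left. *)
  pose d := (4 * (a * c + 1))^-1.
  have ac : 0 <= a * c by rewrite mulr_ge0.
  have d0 : 0 < d by rewrite invr_gt0; lra.
  exists (ball p.1 d `*` ball p.2 d, [set C | 2 * c < C]) => /=.
    split; first by exists (ball p.1 d, ball p.2 d) => //=; split; exact: nbhsx_ballx.
    by exists (2 * c); rewrite num_real.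
  move=> [[u v] C] /= [[pu pv] cC] x.
  set w := u +i* v; set w' := p.1 +i* p.2.
  set y := B w x.
  have yE : y = B w' (x + (w - w') *: A y).
    have yx : y = x + w *: A y := resolventE w x.
    by rewrite -[LHS](BK w'); congr (B w' _); rewrite scalerBl addrA -yx.
  have wd : nc (w - w') <= 2 * d.
    rewrite (le_trans (normc_le_ReIm _))//=.
    move: pu pv; rewrite /ball /= => pu pv; rewrite distrC [X in _ + X]distrC; lra.
  have h1 : rnorm y <= c * (rnorm x + 2 * d * (a * rnorm y)).
    rewrite {1}yE (le_trans (Bc _))// ler_wpM2l// (le_trans (ler_rnormD _ _))//.
    rewrite lerD2l rnormZ ler_pM ?normc_ge0 ?rnorm_ge0//.
  have h2 : c * (2 * d * (a * rnorm y)) <= rnorm y / 2.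
    have -> : c * (2 * d * (a * rnorm y)) = (2 * d * (a * c)) * rnorm y by ring.
    rewrite mulrC ler_wpM2l ?rnorm_ge0//.
    have : 4 * (a * c + 1) * d = 1 by rewrite mulfV// gt_eqF//; lra.
    nra.
  have h3 : 2 * c * rnorm x <= C * rnorm x by rewrite ler_wpM2r ?rnorm_ge0// ltW.
  rewrite mulrDr in h1; lra.
exists (`|C| + 1) => [|w wr x]; first by rewrite addr_ge0.
have : P (`|C| + 1) (Re w, Im w).
  apply: CP; first by rewrite (le_lt_trans (ler_norm C))// ltrDl.
  by split; rewrite /= in_itv /= -ler_norml (le_trans _ wr)// (normc_Re, normc_Im).
by move/(_ x); rewrite /=; case: w {wr}.
Qed.

End Resolvent.

(** * Decay of the powers of an operator with spectrum zero *)

Lemma exprn_small (R : realType) (q eps : R) : 0 <= q < 1 -> 0 < eps ->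
  exists N, forall n, (N <= n)%N -> q ^+ n <= eps.
Proof.
move=> /andP[q0 q1] eps0.
have : q ^+ n @[n --> \oo] --> (0 : R) by apply: cvg_expr; rewrite ger0_norm.
move/cvgrPdist_le => /(_ _ eps0)[N _ NP]; exists N => n /NP.
by rewrite sub0r normrN ger0_norm// exprn_ge0.
Qed.

Section Quasinilpotent.
Context (R : realType) (H : completeNormedModType R[i]).
Context (A : {linear H -> H}).
Context (a : R) (a0 : 0 <= a) (Aa : forall x, rnorm (A x) <= a * rnorm x).
Context (B : R[i] -> {linear H -> H}).
Hypothesis BK : forall w x, B w (x - w *: A x) = x.
Hypothesis KB : forall w x, B w x - w *: A (B w x) = x.
Hypothesis Bb : forall w, exists2 c : R, 0 <= c & forall x, rnorm (B w x) <= c * rnorm x.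

(** The finite geometric sum multiplied by 1 - uA telescopes. *)
Lemma resolvent_geometric u n x :
  B u (x - u ^+ n *: iter n A x) = \sum_(k < n) u ^+ k *: iter k A x.
Proof.
have -> : x - u ^+ n *: iter n A x =
    \sum_(k < n) (u ^+ k *: iter k A x - u *: A (u ^+ k *: iter k A x)).
  rewrite -opprB; have -> : u ^+ n *: iter n A x - x =
    \sum_(0 <= k < n) (u ^+ k.+1 *: iter k.+1 A x - u ^+ k *: iter k A x).
    by rewrite telescope_sumr// expr0 scale1r.
  rewrite big_mkord -sumrN; apply: eq_bigr => k _.
  by rewrite opprB (linearZ_LR A) /= scalerA -exprS.
by rewrite linear_sum; apply: eq_bigr => k _; rewrite BK.
Qed.

Definition resolvent_avg (n : nat) (z w : R[i]) (x : H) : H :=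
  (n%:R)^-1 *: \sum_(j < n) B (w * z ^+ j) x.

(** Averaging the finite geometric sum over the n rotations of w kills every term with 0 < k < n. *)
Lemma resolvent_avgE n z w x : n.-primitive_root z ->
  resolvent_avg n z w (x - w ^+ n *: iter n A x) = x.
Proof.
move=> pz; rewrite /resolvent_avg; have n0 := prim_order_gt0 pz.
have nR : n%:R != 0 :> R[i] by rewrite pnatr_eq0 -lt0n.
have E (j : 'I_n) : B (w * z ^+ j) (x - w ^+ n *: iter n A x) =
    \sum_(k < n) ((z ^+ j) ^+ k * w ^+ k) *: iter k A x.
  have := resolvent_geometric (w * z ^+ j) n x.
  rewrite exprMn -[in (z ^+ j) ^+ n]exprM mulnC exprM (prim_expr_order pz) expr1n mulr1.
  by move=> ->; apply: eq_bigr => k _; rewrite exprMn mulrC.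
rewrite (eq_bigr _ (fun j _ => E j)) exchange_big /=.
rewrite (bigD1 (Ordinal n0)) //= [X in _ + X]big1 ?addr0 => [|k k0].
  rewrite (eq_bigr (fun=> x)) => [|j _]; last by rewrite !expr0 mulr1 scale1r.
  by rewrite sumr_const card_ord -(scaler_nat n x) scalerA mulVf// scale1r.
under eq_bigr do rewrite -scalerA.
rewrite -scaler_suml (sum_primitive_root _ pz).
by rewrite gtnNdvd ?ltn_ord ?lt0n// scale0r.
Qed.

Lemma resolvent_avgB n z w v x :
  resolvent_avg n z w x - resolvent_avg n z v x =
  (n%:R)^-1 *: \sum_(j < n) (B (w * z ^+ j) x - B (v * z ^+ j) x).
Proof. by rewrite /resolvent_avg -scalerBr sumrB. Qed.

Lemma rnorm_avg n (F : 'I_n -> H) (c : R) : (0 < n)%N ->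
  (forall j, rnorm (F j) <= c) -> rnorm ((n%:R)^-1 *: \sum_(j < n) F j) <= c.
Proof.
move=> n0 Fc; have nR : 0 < n%:R :> R by rewrite ltr0n.
have -> : (n%:R)^-1 = (n%:R^-1 : R)%:C.
  by rewrite fmorphV rmorph_nat.
rewrite rnormZ normc_real ger0_norm ?invr_ge0 ?ler0n// mulrC ler_pdivrMr//.
rewrite (le_trans (ler_rnorm_sum _ _ _))// (le_trans (ler_sum _ (fun j _ => Fc j)))//.
by rewrite sumr_const card_ord mulr_natr.
Qed.

Definition vanishing_powers (r : R) := forall eps : R, 0 < eps ->
  exists N, forall n, (N <= n)%N -> forall x,
    r ^+ n * rnorm (iter n A x) <= eps * rnorm x.

Lemma vanishing_powers_le r s : 0 <= r <= s ->
  vanishing_powers s -> vanishing_powers r.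
Proof.
move=> /andP[r0 rs] Q eps /Q[N NP]; exists N => n /NP + x => /(_ x).
by apply: le_trans; rewrite ler_wpM2r ?rnorm_ge0// lerXn2r ?nnegrE// (le_trans r0).
Qed.

(* Rickart's argument: [(1 - w^n A^n)^-1] is an average of resolvents, hence
   Lipschitz in [w] uniformly in [n]. *)
Lemma vanishing_powers_step (rho C d r : R) : 0 <= C ->
  (forall w, nc w <= rho -> forall x, rnorm (B w x) <= C * rnorm x) ->
  0 < d -> 8 * d * (C * (a * C)) <= 1 -> 0 <= r -> r + 2 * d <= rho ->
  vanishing_powers r -> vanishing_powers (r + d).
Proof.
move=> C0 BC d0 dC r0 rd Q eps eps0.
have e0 : 0 < (4 * (C + 1))^-1 by rewrite invr_gt0; lra.
have [N NP] := Q _ e0.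
have eC : (4 * (C + 1)) * (4 * (C + 1))^-1 = 1 by rewrite mulfV// gt_eqF//; lra.
(* At radius r the average is within 1/4 of the identity, since r^n A^n is small; moving to radius r
   + 2d changes it by at most 1/4. An inverse of 1 - w^n A^n within 1/2 of the identity forces |w^n
   A^n x| <= |x|. *)
have bnd n x : (N < n)%N -> (r + 2 * d) ^+ n * rnorm (iter n A x) <= rnorm x.
  move=> Nn; have n0 : (0 < n)%N by case: (n) Nn.
  have [z pz] := @primitive_root_exists R n n0.
  have z1 := normc_primitive_root pz.
  pose v := r%:C; pose w := (r + 2 * d)%:C.
  have vj j : nc (v * z ^+ j) <= rho.
    by rewrite Normc.normcM normcX z1 expr1n mulr1 normc_real ger0_norm//; lra.
  have wj j : nc (w * z ^+ j) <= rho.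
    by rewrite Normc.normcM normcX z1 expr1n mulr1 normc_real ger0_norm//; lra.
  have near_v t : rnorm (resolvent_avg n z v t - t) <= rnorm t / 4.
    rewrite -{2}(@resolvent_avgE n z v t pz) /resolvent_avg -scalerBr -sumrB.
    apply: rnorm_avg => // j; rewrite -linearB /= opprB addrC subrK.
    rewrite (le_trans (BC _ (vj j) _))// rnormZ normcX normc_real ger0_norm//.
    have := NP n (ltnW Nn) t => h; rewrite (le_trans (ler_wpM2l C0 h))//.
    have := rnorm_ge0 t; nra.
  have near_w t : rnorm (resolvent_avg n z w t - resolvent_avg n z v t) <= rnorm t / 4.
    rewrite resolvent_avgB; apply: rnorm_avg => // j.
    rewrite (resolventB BK KB) -mulrBl rnormZ Normc.normcM normcX z1 expr1n mulr1.
    have -> : w - v = (2 * d)%:C by rewrite -rmorphB; congr (_%:C); ring.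
    rewrite normc_real ger0_norm; last by lra.
    have h1 := BC _ (vj j) t.
    have h2 := Aa (B (v * z ^+ j) t).
    have h3 := BC _ (wj j) (A (B (v * z ^+ j) t)).
    have h4 := ler_wpM2l a0 h1.
    have h5 := ler_wpM2l C0 (le_trans h2 h4).
    have d2 : 0 <= 2 * d by lra.
    rewrite (le_trans (ler_wpM2l d2 (le_trans h3 h5)))//.
    have := rnorm_ge0 t; nra.
  pose y := w ^+ n *: iter n A x.
  have yE : y = resolvent_avg n z w (x - y) - (x - y).
    by rewrite (@resolvent_avgE n z w x pz) opprB addrC subrK.
  have h1 : rnorm y <= rnorm (x - y) / 4 + rnorm (x - y) / 4.
    rewrite {1}yE -(subrK (resolvent_avg n z v (x - y)) (resolvent_avg n z w (x - y))).
    by rewrite -addrA (le_trans (ler_rnormD _ _))// lerD.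
  have h2 := ler_rnormB x y.
  have -> : (r + 2 * d) ^+ n * rnorm (iter n A x) = rnorm y.
    by rewrite rnormZ normcX normc_real ger0_norm//; lra.
  lra.
(* Boundedness at radius r + 2d becomes decay, with ratio [q], at radius r + d. *)
pose q := (r + d) / (r + 2 * d).
have q0 : 0 <= q by rewrite divr_ge0//; lra.
have rd0 : 0 < r + 2 * d by lra.
have q1 : q < 1 by rewrite ltr_pdivrMr//; lra.
have [N' N'P] := @exprn_small R q eps (introT andP (conj q0 q1)) eps0.
exists (maxn N.+1 N') => n; rewrite geq_max => /andP[Nn N'n] x.
have -> : (r + d) ^+ n = q ^+ n * (r + 2 * d) ^+ n.
  by rewrite -exprMn divfK// gt_eqF.
rewrite -mulrA (le_trans (ler_wpM2l _ (bnd n x Nn)))// ?exprn_ge0//.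
by rewrite ler_wpM2r ?rnorm_ge0// N'P.
Qed.

(** A single resolvent bound on the disc of radius r + 1 provides a step [d] that does not depend on
    the radius already reached, so finitely many steps lead from 0 to r. *)
Lemma spectrum0_vanishing_powers r : 0 <= r -> vanishing_powers r.
Proof.
move=> r0.
have [C C0 BC] := resolvent_unif a0 Aa BK KB Bb (r + 1).
pose K := C * (a * C).
have K0 : 0 <= K by rewrite !mulr_ge0.
pose d := (8 * (K + 1))^-1.
have d0 : 0 < d by rewrite invr_gt0; lra.
have dK : 8 * (K + 1) * d = 1 by rewrite mulfV// gt_eqF//; lra.
have d1 : d <= 8^-1 by nra.
have Qj j : vanishing_powers (Num.min (j%:R * d) r).
  elim: j => [|j IH].
    (* At radius 0 the index starts from 1, because 0^0 = 1. *)
    rewrite mul0r min_l// => eps eps0; exists 1%N => -[//|n] _ x.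
    by rewrite exprS !mul0r mulr_ge0 ?rnorm_ge0// ltW.
  have m0 : 0 <= Num.min (j%:R * d) r by rewrite le_min r0 mulr_ge0// ltW.
  have mr : Num.min (j%:R * d) r <= r by rewrite ge_min lexx orbT.
  have step : vanishing_powers (Num.min (j%:R * d) r + d).
    apply: (@vanishing_powers_step (r + 1) C d) => //; rewrite -/K; nra.
  apply: vanishing_powers_le step; rewrite le_min r0 mulr_ge0 ?(ltW d0)//=.
  rewrite -natr1 mulrDl mul1r.
  by case: (leP (j%:R * d) r) => _; rewrite ge_min ?lexx ?lerDl ?(ltW d0) ?orbT.
have jr := archi_boundP (divr_ge0 r0 (ltW d0)).
have := Qj (Num.bound (r / d)); rewrite min_r//.
by rewrite -ler_pdivrMr// ltW.
Qed.

End Quasinilpotent.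

(** * The characteristic function and its logarithmic derivative *)

Section CharacteristicFunction.
Context (R : realType) (H : completeNormedModType R[i]).
Context (dot : {dot H for Num.conj}) (dot_norm : inner_product_norm dot).
Context (A : {linear H -> H}) (l : R) (e : H) (l0 : 0 < l) (e1 : rnorm e = 1).
Let c : R[i] := 2 * 'i%R * l%:C.
Hypothesis Asym : forall x y, dot (A x) y = dot x (A y) + c * dot x e * dot e y.
Context (a : R) (a0 : 0 <= a) (Aa : forall x, rnorm (A x) <= a * rnorm x).
Context (B : R[i] -> {linear H -> H}).
Hypothesis BK : forall w x, B w (x - w *: A x) = x.
Hypothesis KB : forall w x, B w x - w *: A (B w x) = x.
Hypothesis Bb : forall w, exists2 c : R, 0 <= c & forall x, rnorm (B w x) <= c * rnorm x.

(** Livsic's characteristic function of A in the variable w = 1/z. *)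
Definition charfun (w : R[i]) : R[i] := 1 + c * w * dot (B w e) e.

(** The conjugate in the second slot undoes conjugate-linearity, so this is a power series in w. *)
Definition logder (w : R[i]) : R[i] := dot (B w e) (B (Num.conj w) e).

Definition logder_coef (n : nat) : R[i] :=
  \sum_(k < n.+1) dot (iter k A e) (iter (n - k) A e).

Lemma Re_c : Re c = 0. Proof. by rewrite /c !(Re_mul, Im_mul) /=; ring. Qed.
Lemma Im_c : Im c = 2 * l. Proof. by rewrite /c !(Re_mul, Im_mul) /=; ring. Qed.

(** With x = [B w e], s = (x,e) and u = (Ax,x), pairing x = e + wAx with x gives |x|^2 = conj s +
    wu, while [Asym] gives Im u = l |s|^2. The real and imaginary parts of these relations yield the
    identity. *)
Lemma sqr_normc_charfun w :
  nc (charfun w) ^+ 2 = 1 - 4 * l * Im w * rnorm (B w e) ^+ 2.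
Proof.
set x := B w e; set s := dot x e; set u := dot (A x) x.
have xE : x = e + w *: A x := resolventE KB w e.
have n2 : (rnorm x ^+ 2)%:C = Num.conj s + w * u.
  by rewrite -(dot_rnorm dot_norm) {1}xE dotDl dotZl (dotC dot e x).
have uE : u = Num.conj u + c * s * Num.conj s.
  by rewrite {1}/u Asym (dotC dot x (A x)) (dotC dot e x).
have E1 := congr1 (@Re R) n2; have E2 := congr1 (@Im R) n2.
have E3 := congr1 (@Im R) uE.
move: E1 E2 E3.
rewrite !(Re_add, Im_add, Re_mul, Im_mul, Re_conjc, Im_conjc, Re_c, Im_c) /= => E1 E2 E3.
rewrite sqr_normcE /charfun -/x -/s !(Re_add, Im_add, Re_mul, Im_mul, Re_c, Im_c) /= E1.
have U : l * (Re s ^+ 2 + Im s ^+ 2) = Im u by lra.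
transitivity (1 - 4 * l * (Re w * Im s + Im w * Re s) +
    4 * l * (Re w ^+ 2 + Im w ^+ 2) * (l * (Re s ^+ 2 + Im s ^+ 2))); first by ring.
rewrite U; have -> : Im s = Re w * Im u + Im w * Re u by lra.
ring.
Qed.

(** The adjoint of [B w] differs from the resolvent at conj w only through the rank one part of
    [Asym]. *)
Lemma dot_resolvent w x (y := B (Num.conj w) e) :
  dot (B w x) e * (1 - w * c * dot e y) = dot x y.
Proof.
have eE : dot (B w x) e = dot (B w x) y - w * dot (B w x) (A y).
  by rewrite -{1}(KB (Num.conj w) e) dotBr dotZr conjCK.
have xE : B w x = x + w *: A (B w x) := resolventE KB w x.
have : dot x y = dot (B w x) y - w * dot (A (B w x)) y.
  by rewrite {1}xE dotDl dotZl addrK.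
by rewrite Asym => ->; rewrite mulrBr mulr1 {1}eE; ring.
Qed.

(** The second factor is the conjugate of S(conj w), so this is the symmetry principle for S; it
    shows that S has no zeros. *)
Lemma charfun_inv w : charfun w * (1 - w * c * dot e (B (Num.conj w) e)) = 1.
Proof.
have := dot_resolvent w e; rewrite /charfun.
set s := dot _ _; set t := dot _ _ => st.
by rewrite mulrDl -(mulrA (c * w)) st; ring.
Qed.

Lemma dot_resolventE w x : dot (B w x) e = charfun w * dot x (B (Num.conj w) e).
Proof. by rewrite -dot_resolvent mulrCA charfun_inv mulr1. Qed.

Lemma charfun_neq0 w : charfun w != 0.
Proof.
apply/eqP => S0; have := charfun_inv w; rewrite S0 mul0r => /esym/eqP.
by rewrite oner_eq0.
Qed.

(** First-order Taylor formula with exact remainder. The derivative of w [B w] is the square of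
    [B w], and [dot_resolventE] at [B w e] rewrites c ([B w] [B w] e, e) as c S(w) K(w), whence S' =
    c S K. *)
Lemma charfunB w v : charfun v - charfun w =
  c * (v - w) * charfun w * logder w +
  c * (v - w) ^+ 2 * dot (B v (A (B w (B w e)))) e.
Proof.
have E : v *: B v e - w *: B w e = (v - w) *: B w (B w e) +
    (v - w) ^+ 2 *: B v (A (B w (B w e))).
  have E1 : B v (B w e) = B w (B w e) + (v - w) *: B v (A (B w (B w e))).
    by rewrite -(resolventB BK KB) addrC subrK.
  have E2 : B v e = B w e + (v - w) *: B v (A (B w e)).
    by rewrite -(resolventB BK KB) addrC subrK.
  have E3 : B v (B w e) = B v e + w *: B v (A (B w e)).
    by rewrite -linearZ_LR -linearD -(resolventE KB).
  rewrite expr2 -scalerA -scalerDr -E1 E3.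
  set q := B v (A (B w e)) in E2 E3 *.
  have -> : w *: B w e = w *: B v e - (w * (v - w)) *: q.
    by rewrite E2 scalerDr scalerA addrK.
  by rewrite opprB scalerDr scalerA [_ * w]mulrC scalerBl addrCA addrC.
transitivity (c * dot (v *: B v e - w *: B w e) e).
  by rewrite /charfun dotBl !dotZl; ring.
by rewrite E dotDl !dotZl (dot_resolventE w (B w e)) -/(logder w); ring.
Qed.

(** In passing from M to M + 1, one substitution x = e + wAx is made in the left slot and y = e +
    conj(w) Ay in each remaining term; the terms without a further power of w make up the
    coefficient of w^M. *)
Lemma logder_expansion w M :
  logder w = \sum_(n < M) logder_coef n * w ^+ n +
    w ^+ M * (dot (iter M A (B w e)) (B (Num.conj w) e) +
      \sum_(k < M) dot (iter k A e) (iter (M - k) A (B (Num.conj w) e))).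
Proof.
set y := B (Num.conj w) e.
have iterD n u v : iter n A (u + v) = iter n A u + iter n A v.
  by elim: n => //= n ->; rewrite linearD.
have yE n : iter n A y = iter n A e + Num.conj w *: iter n.+1 A y.
  by rewrite {1}/y (resolventE KB) iterD iter_scale -iterSr.
have xE n : iter n A (B w e) = iter n A e + w *: iter n.+1 A (B w e).
  by rewrite {1}(resolventE KB) iterD iter_scale -iterSr.
elim: M => [|M IH]; first by rewrite !big_ord0 expr0 add0r addr0 mul1r.
rewrite {}IH big_ord_recr /= -addrA; congr (_ + _).
rewrite exprS (mulrC w) -mulrA [logder_coef M * _]mulrC -mulrDr; congr (_ * _).
rewrite {1}xE dotDl dotZl addrAC.
have -> : dot (iter M A e) y + \sum_(k < M) dot (iter k A e) (iter (M - k) A y) =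
   \sum_(k < M.+1) dot (iter k A e) (iter (M - k) A y).
  by rewrite big_ord_recr /= subnn addrC.
rewrite mulrDr [RHS]addrCA [RHS]addrC; congr (_ + _).
rewrite mulr_sumr /logder_coef -big_split /=; apply: eq_bigr => k _.
by rewrite yE dotDr dotZr conjCK subSn// -ltnS.
Qed.

(** Decay at radius 4r yields the factor 4^-n; the finitely many initial indices are absorbed in
    [D]. *)
Lemma geometric_decay (r : R) : 0 <= r -> exists2 D : R, 0 <= D &
  forall n x, r ^+ n * rnorm (iter n A x) <= D * 4^-1 ^+ n * rnorm x.
Proof.
move=> r0; have r4 : 0 <= 4 * r by rewrite mulr_ge0.
have [N NP] := spectrum0_vanishing_powers a0 Aa BK KB Bb r4 ltr01.
have itA n x : rnorm (iter n A x) <= a ^+ n * rnorm x.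
  elim: n => [|n IH]; first by rewrite mul1r.
  by rewrite exprS -mulrA (le_trans (Aa _))// ler_wpM2l.
have E n t : r ^+ n * t = 4^-1 ^+ n * ((4 * r) ^+ n * t).
  by rewrite mulrA -exprMn mulrA mulVf// mul1r.
exists (1 + \sum_(n < N) (4 * r * a) ^+ n).
  by rewrite addr_ge0// sumr_ge0// => n _; rewrite exprn_ge0// mulr_ge0.
move=> n x; rewrite E -mulrA [leRHS]mulrCA ler_wpM2l ?exprn_ge0// ?invr_ge0//.
have S0 : 0 <= \sum_(n < N) (4 * r * a) ^+ n.
  by apply: sumr_ge0 => k _; rewrite exprn_ge0// mulr_ge0.
have [Nn|nN] := leqP N n.
  rewrite (le_trans (NP n Nn x))// ler_wpM2r ?rnorm_ge0// lerDl//.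
rewrite (le_trans (ler_wpM2l (exprn_ge0 n r4) (itA n x)))// mulrA -exprMn.
rewrite ler_wpM2r ?rnorm_ge0// (bigD1 (Ordinal nN)) //= addrCA lerDl addr_ge0//.
by apply: sumr_ge0 => k _; rewrite exprn_ge0// mulr_ge0.
Qed.

(** The remainder consists of M + 1 terms of size 4^-M, uniformly on the disc; M 2^-M <= 1 leaves
    2^-M. *)
Lemma logder_approx (r : R) : 0 <= r -> exists2 E : R, 0 <= E &
  forall w, nc w <= r -> forall M,
    nc (logder w - \sum_(n < M) logder_coef n * w ^+ n) <= E * 2^-1 ^+ M.
Proof.
move=> r0; have [D D0 DP] := geometric_decay r0.
have [C C0 BC] := resolvent_unif a0 Aa BK KB Bb r.
have Be w : nc w <= r -> rnorm (B w e) <= C by move=> /BC/(_ e); rewrite e1 mulr1.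
exists (D * C * C + D * D * C) => [|w wr M]; first by rewrite !(addr_ge0, mulr_ge0).
rewrite (logder_expansion w M) addrC addKr Normc.normcM normcX.
have wr' : nc (Num.conj w) <= r by rewrite normc_conj.
set x := B w e; set y := B _ e.
have w0 := normc_ge0 w.
have wDP n t : nc w ^+ n * rnorm (iter n A t) <= D * 4^-1 ^+ n * rnorm t.
  by apply: le_trans (DP n t); rewrite ler_wpM2r ?rnorm_ge0// lerXn2r ?nnegrE.
have h1 : nc w ^+ M * nc (dot (iter M A x) y) <= 4^-1 ^+ M * (D * C * C).
  rewrite (le_trans (ler_wpM2l (exprn_ge0 _ w0) (normc_dot dot_norm _ _)))// mulrA.
  have -> : 4^-1 ^+ M * (D * C * C) = (D * 4^-1 ^+ M * C) * C by ring.
  rewrite ler_pM ?mulr_ge0 ?exprn_ge0 ?rnorm_ge0 ?Be//.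
  by rewrite (le_trans (wDP _ _))// ler_wpM2l ?Be// mulr_ge0// exprn_ge0// invr_ge0.
have h2 (k : 'I_M) : nc w ^+ M * nc (dot (iter k A e) (iter (M - k) A y)) <=
    4^-1 ^+ M * (D * D * C).
  rewrite (le_trans (ler_wpM2l (exprn_ge0 _ w0) (normc_dot dot_norm _ _)))//.
  have kM : (k <= M)%N := ltnW (ltn_ord k).
  have XM (t : R) : t ^+ M = t ^+ k * t ^+ (M - k) by rewrite -exprD subnKC.
  rewrite !XM mulrACA.
  have regroup (p q : R) : p * q * (D * D * C) = (D * p * 1) * (D * q * C) by ring.
  rewrite regroup.
  rewrite ler_pM ?mulr_ge0 ?exprn_ge0 ?rnorm_ge0//.
    by have := wDP k e; rewrite e1.
  by rewrite (le_trans (wDP _ _))// ler_wpM2l ?Be// mulr_ge0// exprn_ge0// invr_ge0.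
have q0 : 0 <= 4^-1 ^+ M :> R by rewrite exprn_ge0// invr_ge0.
have h3 : nc w ^+ M * nc (\sum_(k < M) dot (iter k A e) (iter (M - k) A y)) <=
    M%:R * (4^-1 ^+ M * (D * D * C)).
  rewrite (le_trans (ler_wpM2l (exprn_ge0 _ w0) (normc_sum _ _ _)))// mulr_sumr.
  rewrite (le_trans (ler_sum _ (fun k _ => h2 k)))//.
  by rewrite sumr_const card_ord mulr_natl.
rewrite (le_trans (ler_wpM2l (exprn_ge0 _ w0) (le_normcD _ _)))// mulrDr.
rewrite (le_trans (lerD h1 h3))//.
have q42 : 4^-1 ^+ M = 2^-1 ^+ M * 2^-1 ^+ M :> R.
  by rewrite -exprMn; congr (_ ^+ _); field.
have p0 : 0 <= 2^-1 ^+ M :> R by rewrite exprn_ge0// invr_ge0.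
have p1 : 2^-1 ^+ M <= 1 :> R by rewrite exprn_ile1// ?invr_ge0// invf_le1// ler1n.
have Mp : M%:R * 2^-1 ^+ M <= 1 :> R.
  rewrite exprVn ler_pdivrMr ?exprn_gt0// mul1r -natrX ler_nat ltnW//.
  exact: ltn_expl.
have c1 : 0 <= D * C * C by rewrite !mulr_ge0.
have c2 : 0 <= D * D * C by rewrite !mulr_ge0.
rewrite q42 mulrDl lerD//.
  by rewrite mulrC ler_wpM2l// ler_piMl.
have -> : M%:R * (2^-1 ^+ M * 2^-1 ^+ M * (D * D * C)) =
    (D * D * C * 2^-1 ^+ M) * (M%:R * 2^-1 ^+ M) by ring.
by rewrite ler_piMr// mulr_ge0.
Qed.

End CharacteristicFunction.

(** * Derivatives along rays and vanishing of the coefficients of the logarithmic derivative *)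

Lemma is_derive_quadratic (R : realType) (f : R -> R) (t D K : R) :
  (forall h, `|h| <= 1 -> `|f (t + h) - f t - h * D| <= K * h ^+ 2) ->
  is_derive t 1 f D.
Proof.
move=> fK.
have cv : h^-1 *: ((f \o shift t) (h *: (1 : R)) - f t) @[h --> 0^'] --> D.
  apply/cvgrPdist_le => eps eps0; near=> h.
  have h0 : h != 0 by near: h; exact: nbhs_dnbhs_neq.
  have h1 : `|h| <= 1.
    by near: h; apply: dnbhs0_le.
  have h2 : `|h| <= eps / (`|K| + 1).
    by near: h; apply: dnbhs0_le; rewrite divr_gt0// ltr_wpDl.
  have := fK h h1; rewrite /= scaler1 [h + t]addrC => fh.
  have hn : 0 < `|h| by rewrite normr_gt0.
  rewrite -(ler_pM2l hn) -normrM mulrBr.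
  rewrite [h * (_ *: _)](_ : _ = f (t + h) - f t); last first.
    by rewrite /GRing.scale /= mulrA mulfV// mul1r.
  rewrite distrC (le_trans fh)// -real_normK ?num_real// expr2 mulrCA ler_wpM2l//.
  rewrite (@le_trans _ _ ((`|K| + 1) * `|h|))//.
    by rewrite ler_wpM2r// (le_trans (ler_norm K))// lerDl.
  by rewrite mulrC -ler_pdivlMr// ltr_wpDl.
apply: DeriveDef; first by apply/cvg_ex; exists D.
exact: cvg_lim.
Unshelve. all: by end_near.
Qed.

Lemma is_derive_primitive_sum (R : realType) (p : nat -> R) (M : nat) (u : R) :
  is_derive u 1 (fun v : R => \sum_(n < M) (p n / n.+1%:R) * v ^+ n.+1)
    (\sum_(n < M) p n * u ^+ n).
Proof.
have -> : (fun v : R => \sum_(n < M) (p n / n.+1%:R) * v ^+ n.+1) =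
    \sum_(n < M) ((p n / n.+1%:R) \*: (@id R ^+ n.+1)).
  by apply/funext => v; rewrite fct_sumE; apply: eq_bigr => n _; rewrite exprfctE.
apply: is_derive_sum => n.
by apply: is_derive_eq; rewrite /= /GRing.scale /= mulr1 mulrA divfK ?pnatr_eq0.
Qed.

Section LogDerivativeVanishes.
Context (R : realType) (H : completeNormedModType R[i]).
Context (dot : {dot H for Num.conj}) (dot_norm : inner_product_norm dot).
Context (A : {linear H -> H}) (l : R) (e : H) (l0 : 0 < l) (e1 : rnorm e = 1).
Let c : R[i] := 2 * 'i%R * l%:C.
Hypothesis Asym : forall x y, dot (A x) y = dot x (A y) + c * dot x e * dot e y.
Context (a : R) (a0 : 0 <= a) (Aa : forall x, rnorm (A x) <= a * rnorm x).
Context (B : R[i] -> {linear H -> H}).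
Hypothesis BK : forall w x, B w (x - w *: A x) = x.
Hypothesis KB : forall w x, B w x - w *: A (B w x) = x.
Hypothesis Bb : forall w, exists2 c : R, 0 <= c & forall x, rnorm (B w x) <= c * rnorm x.

Local Notation S := (charfun dot l e B).
Local Notation K := (logder dot e B).
Local Notation G := (logder_coef dot A e).

(** Reversing the order of summation conjugates every term. *)
Lemma logder_coef_real n : G n = (Re (G n))%:C.
Proof.
have GJ : Num.conj (G n) = G n.
  rewrite /logder_coef rmorph_sum (reindex_inj rev_ord_inj) /=.
  by apply: eq_bigr => k _; rewrite -dotC subSS subKn// -ltnS.
apply: complexP => //=; have := congr1 (@Im R) GJ; rewrite Im_conjc; lra.
Qed.

(** From S' = c S K the derivative is 2 |S|^2 Re (c z K), and c = 2il is purely imaginary. *)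
Lemma is_derive_sqr_charfun (z : R[i]) (t : R) : nc z = 1 ->
  is_derive t 1 (fun u : R => nc (S (u%:C * z)) ^+ 2)
    (- 4 * l * nc (S (t%:C * z)) ^+ 2 * Im (z * K (t%:C * z))).
Proof.
move=> z1.
have [C C0 BC] := resolvent_unif a0 Aa BK KB Bb (`|t| + 1).
pose w : R[i] := t%:C * z.
have wle u : nc (u%:C * z) = `|u| by rewrite Normc.normcM normc_real z1 mulr1.
have wC : nc w <= `|t| + 1 by rewrite wle lerDl.
pose L : R := nc (c * S w * K w).
pose Q := 2 * l * (C * (a * (C * C))).
have Q0 : 0 <= Q by rewrite !mulr_ge0// ltW.
(* The constant collects the cross term of S(w) with the remainder, bounded through [Q], and the
   square of the increment, at most (L + Q)|h| in modulus. *)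
apply: (@is_derive_quadratic _ _ _ _ (2 * nc (S w) * Q + (L + Q) ^+ 2)) => h h1.
pose v : R[i] := (t + h)%:C * z.
have vC : nc v <= `|t| + 1 by rewrite wle (le_trans (ler_normD _ _))// lerD2l.
have vw : v - w = h%:C * z by rewrite /v /w -mulrBl -rmorphB addrAC subrr add0r.
pose rem : R[i] := c * (v - w) ^+ 2 * dot (B v (A (B w (B w e)))) e.
have remle : nc rem <= Q * h ^+ 2.
  have cn : nc c = 2 * l.
    rewrite /c !Normc.normcM normc_imaginary mulr1 normc_real gtr0_norm//.
    have -> : (2 : R[i]) = (2 : R)%:C by rewrite rmorph_nat.
    by rewrite normc_real ger0_norm.
  rewrite /rem vw Normc.normcM (Normc.normcM c) cn normcX (Normc.normcM h%:C) z1 mulr1.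
  rewrite normc_real real_normK ?num_real//.
  have dle : nc (dot (B v (A (B w (B w e)))) e) <= C * (a * (C * C)).
    rewrite (le_trans (normc_dot dot_norm _ _))// e1 mulr1.
    rewrite (le_trans (BC _ vC _))// ler_wpM2l// (le_trans (Aa _))// ler_wpM2l//.
    rewrite (le_trans (BC _ wC _))// ler_wpM2l//.
    by have := BC _ wC e; rewrite e1 mulr1.
  have l2 : 0 <= 2 * l by rewrite mulr_ge0// ltW.
  by rewrite /Q mulrAC ler_wpM2r ?sqr_ge0// ler_wpM2l.
have SE : S v = S w + (h%:C * (c * z * S w * K w) + rem).
  rewrite -[S v](subrK (S w)) addrC; congr (_ + _).
  by rewrite (charfunB Asym BK KB) -/rem vw /c; ring.
rewrite SE sqr_normcD.
set p := S w; set q := c * z * p * K w.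
have q_L : nc q = L by rewrite /q /L -[c * z * p]mulrAC !Normc.normcM z1 mulr1.
have pq : Re (Num.conj p * (h%:C * q)) = h * (- 2 * l * nc p ^+ 2 * Im (z * K w)).
  have -> : Num.conj p * (h%:C * q) = h%:C * (nc p ^+ 2)%:C * (c * (z * K w)).
    by rewrite -mulc_conj /q; ring.
  rewrite -rmorphM [c * _]mulrC.
  move: (Re_c l) (Im_c l); rewrite -/c; move: (c) => c' cR cI.
  by rewrite !(Re_mul, Im_mul) cR cI /=; ring.
rewrite mulrDr Re_add pq.
have -> : nc p ^+ 2 + 2 * (h * (- 2 * l * nc p ^+ 2 * Im (z * K w)) + Re (Num.conj p * rem)) +
    nc (h%:C * q + rem) ^+ 2 - nc p ^+ 2 - h * (- 4 * l * nc p ^+ 2 * Im (z * K w)) =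
    2 * Re (Num.conj p * rem) + nc (h%:C * q + rem) ^+ 2 by ring.
rewrite (le_trans (ler_normD _ _))// [leRHS]mulrDl lerD//.
  have -> : 2 * nc p * Q * h ^+ 2 = 2 * (nc p * (Q * h ^+ 2)) by ring.
  rewrite normrM ger0_norm// ler_wpM2l// (le_trans (normc_Re _))//.
  by rewrite Normc.normcM normc_conj ler_wpM2l ?normc_ge0.
have hh : h ^+ 2 = `|h| ^+ 2 by rewrite real_normK ?num_real.
rewrite ger0_norm ?sqr_ge0// hh -exprMn.
have L0 : 0 <= L by exact: normc_ge0.
rewrite lerXn2r ?nnegrE ?normc_ge0 ?mulr_ge0 ?addr_ge0//.
rewrite (le_trans (le_normcD _ _))// [leRHS]mulrDl lerD//.
  by rewrite Normc.normcM normc_real q_L mulrC.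
by rewrite (le_trans remle)// hh expr2 ler_wpM2l// ler_piMl.
Qed.

(** Along the ray, ln |S|^2 and -4l times the partial sum start from 0 and have derivatives within
    4lE 2^-M of each other; ln |S|^2 <= 0 in the upper half plane. *)
Lemma sine_sum_lower_bound (r : R) : 0 < r -> exists2 E : R, 0 <= E &
  forall M z, nc z = 1 -> 0 <= Im z ->
  - (E * 2^-1 ^+ M) <=
    \sum_(n < M) (Re (G n) * r ^+ n.+1 / n.+1%:R) * Im (z ^+ n.+1).
Proof.
move=> r0; have [E E0 EP] := logder_approx dot_norm e1 a0 Aa BK KB Bb (ltW r0).
exists (r * E) => [|M z z1 zI]; first by rewrite mulr_ge0// ltW.
have l4 : 0 < 4 * l by rewrite mulr_gt0.
pose f (u : R) : R := nc (S (u%:C * z)) ^+ 2.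
have f0 u : 0 < f u.
  rewrite exprn_gt0// lt_def normc_ge0 andbT; apply/eqP => /Normc.eq0_normc.
  by apply/eqP; exact: (charfun_neq0 Asym KB).
pose g n : R := Re (G n) * Im (z ^+ n.+1).
pose Lam (u : R) : R := \sum_(n < M) (g n / n.+1%:R) * u ^+ n.+1.
pose phi (u : R) : R := ln (f u) + 4 * l * Lam u.
pose dphi (u : R) : R := - 4 * l * Im (z * K (u%:C * z)) + 4 * l * \sum_(n < M) g n * u ^+ n.
have fD (u : R) : is_derive u 1 f (- 4 * l * f u * Im (z * K (u%:C * z))).
  exact: is_derive_sqr_charfun.
have LamD (u : R) : is_derive u 1 Lam (\sum_(n < M) g n * u ^+ n).
  exact: is_derive_primitive_sum.
have phiD (u : R) : is_derive u 1 phi (dphi u).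
  have lnD := is_derive1_ln (f0 u).
  have -> : phi = (@ln R \o f) + (4 * l) \*: Lam by [].
  apply: is_derive_eq; rewrite /dphi /GRing.scale /=; congr (_ + _).
  by move: (f u) (lt0r_neq0 (f0 u)) => F F0; field.
have dphi_le u : 0 <= u <= r -> `|dphi u| <= 4 * l * (E * 2^-1 ^+ M).
  move=> /andP[u0 ur]; pose w : R[i] := u%:C * z.
  have -> : dphi u = - (4 * l) * Im (z * (K w - \sum_(n < M) G n * w ^+ n)).
    have Es : Im (z * \sum_(n < M) G n * w ^+ n) = \sum_(n < M) g n * u ^+ n.
      rewrite mulr_sumr Im_sum; apply: eq_bigr => n _.
      have -> : z * (G n * w ^+ n) = (Re (G n) * u ^+ n)%:C * z ^+ n.+1.
        by rewrite {1}(logder_coef_real n) /w exprMn -rmorphXn rmorphM exprS; ring.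
      by rewrite /g Im_mul /=; ring.
    by rewrite /dphi -/w -Es mulrBr Im_add Im_opp; ring.
  rewrite normrM normrN (gtr0_norm l4) ler_wpM2l ?(ltW l4)// (le_trans (normc_Im _))//.
  rewrite Normc.normcM z1 mul1r EP// /w Normc.normcM z1 mulr1 normc_real ger0_norm//.
(* [phi] is the difference of the two; the mean value theorem bounds it at [r] by the error of its
   derivative. *)
have [x xr phixr] : exists2 x, x \in `[0, r] & phi r - phi 0 = dphi x * (r - 0).
  apply: (@MVT_segment R phi dphi 0 r (ltW r0) (fun x _ => phiD x)).
  by apply: derivable_within_continuous => x _; exact: ex_derive.
have phi00 : phi 0 = 0.
  rewrite /phi /Lam big1 => [|n _]; last by rewrite exprS mul0r mulr0.
  rewrite /f mul0r /charfun mulr0 mul0r addr0 Normc.normc1 expr1n ln1; lra.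
have lnf : ln (f r) <= 0.
  rewrite -ln1 ler_ln ?posrE//.
  rewrite /f (sqr_normc_charfun dot_norm Asym KB) gerBl.
  have I0 : 0 <= Im (r%:C * z) by rewrite Im_mul /= mul0r addr0 mulr_ge0// ltW.
  by rewrite mulr_ge0 ?sqr_ge0// mulr_ge0// ltW.
have xr' : 0 <= x <= r by move: xr; rewrite in_itv.
have := dphi_le x xr'; rewrite ler_norml => /andP[dlo _].
have -> : \sum_(n < M) (Re (G n) * r ^+ n.+1 / n.+1%:R) * Im (z ^+ n.+1) = Lam r.
  by apply: eq_bigr => n _; rewrite /g; ring.
have h : - (4 * l * (E * 2^-1 ^+ M)) * r <= phi r.
  by rewrite -[phi r]subr0 -{1}phi00 phixr subr0 ler_wpM2r// ltW.
rewrite -(ler_pM2l l4); rewrite /phi in h.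
set X := 2^-1 ^+ M in h *.
have -> : 4 * l * - (r * E * X) = - (4 * l * (E * X)) * r by ring.
lra.
Qed.

Lemma logder_coef0 : G 0 = 1.
Proof. by rewrite /logder_coef big_ord1 /= (dot_rnorm dot_norm) e1 expr1n. Qed.

(** Letting the truncation order grow removes the error, so |G_m| r^m <= (m+1)^2 for all r > 0, a
    Liouville-type bound. *)
Lemma logder_coef_eq0 m : (0 < m)%N -> G m = 0.
Proof.
move=> m0; set g := Re (G m).
have bound (r : R) : 0 < r -> `|g| * r ^+ m.+1 <= m.+1%:R ^+ 2 * r.
  move=> r0; have [E E0 EP] := sine_sum_lower_bound r0.
  pose d n : R := Re (G n) * r ^+ n.+1 / n.+1%:R.
  have M0 : 0 < m.+1%:R :> R by rewrite ltr0n.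
  have d0 : d 0 = r by rewrite /d logder_coef0 /= expr1 divr1 mul1r.
  have dm : `|d m| <= m.+1%:R * r.
    apply/ler_addgt0Pr => eps eps0.
    have q01 : 0 <= (2^-1 : R) < 1 by apply/andP; split; lra.
    have k0 : 0 < eps / (4 * (m.+1%:R * E) + 1).
      by rewrite divr_gt0// ltr_wpDl// !mulr_ge0.
    have [N NP] := exprn_small q01 k0.
    (* [N] makes the truncation error small, and [m.+2] meets the requirement m + 1 < M of
       [sine_coef_le]. *)
    pose M := maxn N m.+2.
    have := @sine_coef_le R M m d (E * 2^-1 ^+ M) (leq_maxr _ _) (EP M) _ m0.
    rewrite d0 => /(_ _)/le_trans; apply; first by rewrite mulr_ge0// exprn_ge0// invr_ge0.
    rewrite mulrDr lerD2l.
    have p0 : 0 <= 2^-1 ^+ M :> R by rewrite exprn_ge0// invr_ge0.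
    have := NP M (leq_maxl _ _); rewrite ler_pdivlMr ?ltr_wpDl// ?mulr_ge0//.
    by set X := 2^-1 ^+ M in p0 *; move=> h; lra.
  move: dm; rewrite /d !normrM normfV (gtr0_norm M0) normrX (gtr0_norm r0) ler_pdivrMr//.
  by rewrite expr2 -mulrA mulrAC mulrA.
have g0 : g = 0.
  apply/eqP; apply: contraT => gn0; have gp : 0 < `|g| by rewrite normr_gt0.
  (* Then |g| r exceeds (m+1)^2, and r <= r^m because r >= 1 and m > 0. *)
  pose r := m.+1%:R ^+ 2 / `|g| + 1.
  have r1 : 1 <= r by rewrite lerDr divr_ge0.
  have r0 : 0 < r by lra.
  have := bound r r0; rewrite exprSr mulrA ler_pM2r//.
  have rm : r <= r ^+ m by rewrite -[leLHS]expr1; apply: ler_weXn2l.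
  move/(le_trans (ler_wpM2l (ltW gp) rm)).
  rewrite /r mulrDr mulr1 [`|g| * _]mulrC divfK ?gt_eqF// => h; exfalso; lra.
by rewrite logder_coef_real -/g g0.
Qed.

End LogDerivativeVanishes.

(** * The Gram matrix of the vectors A^k e *)

Section Gram.
Context (R : realType) (H : completeNormedModType R[i]).
Context (dot : {dot H for Num.conj}) (dot_norm : inner_product_norm dot).
Context (A : {linear H -> H}) (l : R) (e : H) (l0 : 0 < l) (e1 : rnorm e = 1).
Let c : R[i] := 2 * 'i%R * l%:C.
Hypothesis Asym : forall x y, dot (A x) y = dot x (A y) + c * dot x e * dot e y.
Hypothesis logder0 : forall m, (0 < m)%N -> logder_coef dot A e m = 0.

(** The L^2(0,1) inner product of (cx)^k / k! and (cx)^j / j!, where conj c = -c. *)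
Let gram (k j : nat) : R[i] :=
  c ^+ k * (- c) ^+ j / (k`!%:R * j`!%:R * (k + j).+1%:R).

(** The counterpart of [Asym] in the model: integration by parts. *)
Lemma gram_step k j : gram k.+1 j = gram k j.+1 + c * gram k 0 * gram 0 j.
Proof.
rewrite /gram !addn0 add0n addnS addSn !factS !fact0 !exprS !expr0 !natrM.
have h1 : k`!%:R != 0 :> R[i] by rewrite pnatr_eq0 -lt0n fact_gt0.
have h2 : j`!%:R != 0 :> R[i] by rewrite pnatr_eq0 -lt0n fact_gt0.
have h3 : k.+1%:R != 0 :> R[i] by rewrite pnatr_eq0.
have h4 : j.+1%:R != 0 :> R[i] by rewrite pnatr_eq0.
have h5 : (k + j).+2%:R != 0 :> R[i] by rewrite pnatr_eq0.
have E : (k + j).+2%:R = k.+1%:R + j.+1%:R :> R[i] by rewrite -natrD addSn addnS.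
rewrite E in h5 *; move: h1 h2 h3 h4 h5.
by move: (k`!%:R : R[i]) (j`!%:R : R[i]) (k.+1%:R : R[i]) (j.+1%:R : R[i])
  (c ^+ k) ((- c) ^+ j) => f g p q u v *; field; apply/and5P.
Qed.

(** The counterpart of G_(n+1) = 0: by the binomial theorem the sum is a multiple of (-c +
    c)^(n+1). *)
Lemma gram_sum n : \sum_(k < n.+2) gram k (n.+1 - k) = 0.
Proof.
transitivity ((- c + c) ^+ n.+1 / ((n.+1)`!%:R * n.+2%:R)); last first.
  by rewrite addNr exprS !mul0r.
rewrite exprDn mulr_suml; apply: eq_bigr => k _.
have kn : (k <= n.+1)%N by rewrite -ltnS.
rewrite /gram subnKC// -(bin_fact kn) !natrM -(mulr_natl _ 'C(n.+1, k)).
have h1 : k`!%:R != 0 :> R[i] by rewrite pnatr_eq0 -lt0n fact_gt0.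
have h2 : (n.+1 - k)`!%:R != 0 :> R[i] by rewrite pnatr_eq0 -lt0n fact_gt0.
have h3 : n.+2%:R != 0 :> R[i] by rewrite pnatr_eq0.
have h4 : 'C(n.+1, k)%:R != 0 :> R[i] by rewrite pnatr_eq0 -lt0n bin_gt0.
set f : R[i] := k`!%:R in h1 *; set g : R[i] := _`!%:R in h2 *.
set p : R[i] := n.+2%:R in h3 *; set q : R[i] := 'C(_, _)%:R in h4 *.
set u : R[i] := c ^+ k; set v : R[i] := (- c) ^+ _.
move: f g p q u v h1 h2 h3 h4 => f g p q u v *; field.
exact/and4P.
Qed.

(** Induction on antidiagonals. Both sides obey the same recursion along k + j = n + 1, with
    inhomogeneous terms from earlier antidiagonals, so their difference is constant there; both have
    sum zero, so it vanishes. *)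
Lemma dot_iter_gram k j : dot (iter k A e) (iter j A e) = gram k j.
Proof.
suff E n i : (i <= n)%N -> dot (iter i A e) (iter (n - i) A e) = gram i (n - i).
  by have := E (k + j)%N k (leq_addr _ _); rewrite addKn.
elim/ltn_ind: n i => -[_ [|//] _|n IH].
  rewrite (dot_rnorm dot_norm) e1 expr1n /gram !expr0 fact0 !mul1r invr1.
  by [].
pose d i := dot (iter i A e) (iter (n.+1 - i) A e) - gram i (n.+1 - i).
have dS i : (i <= n)%N -> d i.+1 = d i.
  move=> iN; rewrite /d subSS subSn//= gram_step Asym.
  have := IH n (ltnSn n); have IHi := IH i iN i (leqnn _).
  rewrite subnn /= in IHi; rewrite IHi.
  have iN' : (n - i < n.+1)%N by rewrite ltnS leq_subr.
  have IHj := IH (n - i)%N iN' 0 (leq0n _).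
  by rewrite subn0 /= in IHj; rewrite IHj => _; ring.
have dc i : (i <= n.+1)%N -> d i = d 0%N.
  by elim: i => // i IHi iN; rewrite dS// IHi// ltnW.
have d00 : d 0%N = 0.
  have := logder0 (ltn0Sn n); rewrite /logder_coef.
  have dE (i : 'I_n.+2) : dot (iter i A e) (iter (n.+1 - i) A e) =
      d 0%N + gram i (n.+1 - i).
    have iN : (i <= n.+1)%N by rewrite -ltnS.
    by have := dc i iN; rewrite {1}/d => <-; rewrite subrK.
  rewrite (eq_bigr _ (fun i _ => dE i)).
  rewrite big_split /= gram_sum addr0 sumr_const card_ord => /eqP.
  by rewrite mulrn_eq0 /= => /eqP.
by move=> i iN; apply/eqP; rewrite -subr_eq0 -/(d i) dc// d00.
Qed.

End Gram.

(** * Shifted Legendre polynomials on [0,1] *)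

Section ShiftedLegendre.
Context (R : realType).
Implicit Types (p q : {poly R}) (a : R).

Definition unit_integral p : R := \sum_(i < size p) p`_i / i.+1%:R.

Lemma unit_integral_wide n p : (size p <= n)%N ->
  unit_integral p = \sum_(i < n) p`_i / i.+1%:R.
Proof.
move=> pn; rewrite /unit_integral (big_ord_widen n (fun i => p`_i / i.+1%:R) pn).
rewrite big_mkcond; apply: eq_bigr => i _; case: ltnP => // pi.
by rewrite nth_default// mul0r.
Qed.

Lemma unit_integral_linear a p q :
  unit_integral (a *: p + q) = a * unit_integral p + unit_integral q.
Proof.
pose n := maxn (size p) (size q).
have pn : (size p <= n)%N by exact: leq_maxl.
have qn : (size q <= n)%N by exact: leq_maxr.
rewrite !(@unit_integral_wide n)//; last first.
  by rewrite (leq_trans (size_polyD _ _))// geq_max qn (leq_trans (size_scale_leq _ _)).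
rewrite mulr_sumr -big_split; apply: eq_bigr => i _ /=.
by rewrite coefD coefZ mulrDl mulrA.
Qed.

Lemma unit_integralD p q : unit_integral (p + q) = unit_integral p + unit_integral q.
Proof. by rewrite -[p]scale1r unit_integral_linear mul1r scale1r. Qed.

Lemma unit_integralZ a p : unit_integral (a *: p) = a * unit_integral p.
Proof.
rewrite -[a *: p]addr0 unit_integral_linear.
by rewrite [unit_integral 0]/unit_integral size_poly0 big_ord0 addr0.
Qed.

Lemma unit_integralB p q : unit_integral (p - q) = unit_integral p - unit_integral q.
Proof. by rewrite -scaleN1r unit_integralD unit_integralZ mulN1r. Qed.

Lemma unit_integral_deriv p : unit_integral p^`() = p.[1] - p.[0].
Proof.
rewrite (@unit_integral_wide (size p)); last by rewrite (leq_trans (size_poly _ _))// leq_pred.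
rewrite (@horner_coef_wide _ (size p).+1 p 1)// big_ord_recl expr1n mulr1 horner_coef0.
rewrite addrC addKr; apply: eq_bigr => i _.
by rewrite coef_deriv expr1n mulr1 -[_ *+ i.+1]mulr_natr mulfK ?pnatr_eq0.
Qed.

Lemma unit_integral_by_parts p q :
  p.[0] = 0 -> p.[1] = 0 -> unit_integral (p^`() * q) = - unit_integral (p * q^`()).
Proof.
move=> p0 p1; apply/eqP; rewrite -addr_eq0 -unit_integralD -derivM.
by rewrite unit_integral_deriv !hornerM p0 p1 !mul0r subrr.
Qed.

Let u : {poly R} := 'X * ('X - 1).

(** Each differentiation lowers the order of the zeros at 0 and 1 by at most one. *)
Lemma derivn_vanish n j : (j <= n)%N -> exists q, (u ^+ n)^`(j) = u ^+ (n - j) * q.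
Proof.
elim: j => [|j IH] jn; first by exists 1; rewrite mulr1 subn0 derivn0.
have [q Eq] := IH (ltnW jn); rewrite derivnS Eq subnS.
have : (0 < n - j)%N by rewrite subn_gt0.
case: (n - j)%N => // m _; exists (u^`() *+ m.+1 * q + u * q^`()).
by rewrite derivM deriv_exp exprS /=; ring.
Qed.

Lemma derivn_end n j : (j < n)%N ->
  ((u ^+ n)^`(j)).[0] = 0 /\ ((u ^+ n)^`(j)).[1] = 0.
Proof.
move=> jn; have [q ->] := derivn_vanish (ltnW jn).
have : (0 < n - j)%N by rewrite subn_gt0.
case: (n - j)%N => // m _; rewrite exprS !hornerM !hornerE.
by rewrite subrr !(mul0r, mulr0).
Qed.

(** Integrate by parts j times: the boundary terms vanish because j <= n, and the j-th derivative of
    q is zero. *)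
Lemma derivn_ortho n j q : (j <= n)%N -> (size q <= j)%N ->
  unit_integral ((u ^+ n)^`(j) * q) = 0.
Proof.
elim: j q => [|j IH] q jn qj.
  move: qj; rewrite leqn0 size_poly_eq0 => /eqP ->.
  by rewrite mulr0 /unit_integral size_poly0 big_ord0.
have [h0 h1] := derivn_end jn.
rewrite derivnS unit_integral_by_parts// IH ?oppr0 ?(ltnW jn)//.
have [->|q0] := eqVneq q 0; first by rewrite derivC size_poly0.
by rewrite -ltnS (leq_trans (lt_size_deriv q0)).
Qed.

(* Rodrigues' formula. *)
Definition legendre n : {poly R} := (n`!%:R)^-1 *: (u ^+ n)^`(n).

(** Rodrigues' formula with one derivative fewer: the primitive of [legendre n.+1] that vanishes at
    both ends. *)
Definition legendre_primitive n : {poly R} := (n.+1`!%:R)^-1 *: (u ^+ n.+1)^`(n).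

Lemma legendre_primitive_deriv n : (legendre_primitive n)^`() = legendre n.+1.
Proof. by rewrite derivZ -derivnS. Qed.

Lemma legendre_primitive_end n :
  (legendre_primitive n).[0] = 0 /\ (legendre_primitive n).[1] = 0.
Proof. by have [h0 h1] := derivn_end (ltnSn n); rewrite !hornerZ h0 h1 !mulr0. Qed.

(** The relations u'^2 = 4u + 1 and u'' = 2 turn the second derivative back into powers of u. *)
Lemma deriv2_expu n : ((u ^+ n.+2)^`())^`() =
  (n.+2 * (4 * n + 6))%:R *: u ^+ n.+1 + (n.+2 * n.+1)%:R *: u ^+ n.
Proof.
rewrite !scaler_nat.
have u1 : u^`() = 'X *+ 2 - 1.
  by rewrite /u derivM derivB derivX derivC; ring.
have u2 : u^`() ^+ 2 = u *+ 4 + 1 by rewrite u1 /u; ring.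
have u3 : u^`()^`() = 2 by rewrite u1 derivB derivMn derivX derivC subr0.
rewrite deriv_exp /= derivMn derivM deriv_exp /= u3 mulrnAr mulrA -expr2 u2 exprS.
by ring.
Qed.

(** The n-th derivative of [deriv2_expu], normalized by factorials. *)
Lemma legendreB n :
  legendre n.+2 - legendre n = (4 * n + 6)%:R *: legendre_primitive n.
Proof.
rewrite /legendre /legendre_primitive derivSn derivSn deriv2_expu.
rewrite derivnD !derivnZ scalerDr !scalerA.
have f0 : n`!%:R != 0 :> R by rewrite pnatr_eq0 -lt0n fact_gt0.
have n1 : n.+1%:R != 0 :> R by rewrite pnatr_eq0.
have n2 : n.+2%:R != 0 :> R by rewrite pnatr_eq0.
rewrite !factS !natrM.
set a : R := n`!%:R in f0 *; set b : R := n.+1%:R in n1 *; set d : R := n.+2%:R in n2 *.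
have -> : (d * (b * a))^-1 * (d * b) = a^-1 by field; apply/and3P.
by rewrite addrK; congr (_ *: _); field; apply/and3P.
Qed.

Lemma size_legendre n : (size (legendre n) <= n.+1)%N.
Proof.
have sder j p : (size p^`(j) <= size p - j)%N.
  elim: j => [|j IH]; first by rewrite derivn0 subn0.
  rewrite derivnS (leq_trans (size_poly _ _))// subnS.
  by rewrite -!subn1 leq_sub2r.
rewrite (leq_trans (size_scale_leq _ _))// (leq_trans (sder _ _))//.
have su : size u = 3 by rewrite /u mulrC -polyC1 size_mulX ?polyXsubC_eq0// size_XsubC.
by rewrite leq_subLR (leq_trans (size_poly_exp_leq _ _))// su /=; lia.
Qed.

Lemma legendre_ortho_lower n q : (size q <= n)%N -> unit_integral (legendre n * q) = 0.
Proof.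
by move=> qn; rewrite -scalerAl unit_integralZ derivn_ortho// mulr0.
Qed.

Lemma legendre0 : legendre 0 = 1.
Proof. by rewrite /legendre expr0 derivn0 fact0 invr1 scale1r. Qed.

Lemma legendre1 : legendre 1 = 'X *+ 2 - 1.
Proof.
rewrite /legendre expr1 derivn1 invr1 scale1r /u derivM derivB derivX derivC; ring.
Qed.

(** Testing [legendreB] against P_n and integrating by parts gives (2n+3) |P_(n+1)|^2 = (2n+1)
    |P_n|^2. *)
Lemma legendre_norm n : unit_integral (legendre n * legendre n) = (2 * n + 1)%:R^-1.
Proof.
have prim_norm k : unit_integral (legendre_primitive k * legendre k) =
    - unit_integral (legendre k.+1 * legendre k.+1) / (4 * k + 2)%:R.
  case: k => [|k].
    (* P_0 is not the derivative of a [legendre_primitive]; [X] serves instead, as it suffices that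
       the other factor vanish at the ends. *)
    have -> : legendre 0 = ('X : {poly R})^`() by rewrite derivX legendre0.
    have [p0 p1] := legendre_primitive_end 0.
    have := unit_integral_by_parts 'X p0 p1; rewrite legendre_primitive_deriv => h.
    rewrite -[LHS]opprK -h mulNr; congr (- _).
    have X1 : 'X = 2^-1 *: (legendre 1 + legendre 0).
      rewrite legendre1 legendre0 subrK -(scaler_nat 2 'X) scalerA mulVf ?scale1r//.
    rewrite X1 -scalerAr unit_integralZ mulrDr unit_integralD.
    rewrite [X in _ + X]legendre_ortho_lower ?addr0 1?mulrC//.
    by rewrite legendre0 size_poly1.
  have [p0 p1] := legendre_primitive_end k.+1.
  have := unit_integral_by_parts (legendre_primitive k) p0 p1.
  rewrite !legendre_primitive_deriv => h.
  rewrite -[LHS]opprK -h mulNr; congr (- _).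
  have k0 : (4 * k + 6)%:R != 0 :> R by rewrite pnatr_eq0 addn_eq0 andbF.
  have -> : legendre_primitive k = (4 * k + 6)%:R^-1 *: (legendre k.+2 - legendre k).
    by rewrite legendreB scalerA mulVf// scale1r.
  rewrite -scalerAr unit_integralZ mulrBr unit_integralB.
  rewrite [X in _ - X]legendre_ortho_lower ?subr0.
    by rewrite mulrC; congr (_ / _%:R); lia.
  exact: leq_trans (size_legendre k) _.
elim: n => [|n IH].
  rewrite legendre0 mulr1 /unit_integral size_poly1 big_ord1 polyseq1 /=.
  by rewrite divr1 invr1.
have sn : unit_integral ((legendre n.+2 - legendre n) * legendre n) =
    - unit_integral (legendre n * legendre n).
  rewrite mulrBl unit_integralB [X in X - _]legendre_ortho_lower ?sub0r//.
  exact: leq_trans (size_legendre n) _.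
move: sn; rewrite legendreB -scalerAl unit_integralZ prim_norm IH.
set N := unit_integral _.
have a0 : (4 * n + 6)%:R = 2 * (2 * n + 3)%:R :> R by rewrite -natrM; congr _%:R; lia.
have b0 : (4 * n + 2)%:R = 2 * (2 * n + 1)%:R :> R by rewrite -natrM; congr _%:R; lia.
have -> : (2 * n.+1 + 1 = 2 * n + 3)%N by lia.
have a1 : (2 * n + 3)%:R != 0 :> R by rewrite pnatr_eq0 addn_eq0 andbF.
have b1 : (2 * n + 1)%:R != 0 :> R by rewrite pnatr_eq0 addn_eq0 andbF.
rewrite a0 b0; set a : R := (2 * n + 3)%:R in a1 *; set b : R := (2 * n + 1)%:R in b1 *.
move=> h; apply: (mulfI a1); rewrite mulfV//.
have : 2 * a * (- N / (2 * b)) = - (a * N) / b by field.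
rewrite h -mulN1r => /(mulIf (invr_neq0 b1)) /eqP.
by rewrite eqr_opp => /eqP <-.
Qed.

Lemma legendre_ortho n m : n != m -> unit_integral (legendre n * legendre m) = 0.
Proof.
wlog nm : n m / (m < n)%N => [W|_].
  by rewrite neq_ltn => /orP[h|h]; [rewrite mulrC|]; apply: W => //; rewrite gt_eqF.
by rewrite legendre_ortho_lower// (leq_trans (size_legendre m)).
Qed.

End ShiftedLegendre.

Section UnitIntegralOfProducts.
Context (R : realType).
Implicit Types (p q : {poly R}).

Lemma unit_integral_sum n (F : 'I_n -> {poly R}) :
  unit_integral (\sum_(i < n) F i) = \sum_(i < n) unit_integral (F i).
Proof.
elim/big_rec2: _ => [|i x y _ <-]; last exact: unit_integralD.
by rewrite /unit_integral size_poly0 big_ord0.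
Qed.

Lemma unit_integralXn n : unit_integral ('X^n : {poly R}) = n.+1%:R^-1.
Proof.
rewrite /unit_integral size_polyXn (bigD1 ord_max) //= coefXn eqxx mul1r.
rewrite big1 ?addr0// => i; rewrite -val_eqE /= coefXn => /negPf ->.
by rewrite mul0r.
Qed.

Lemma unit_integralM p q : unit_integral (p * q) =
  \sum_(i < size p) \sum_(j < size q) p`_i * q`_j / (i + j).+1%:R.
Proof.
rewrite -{1}[p]coefK poly_def mulr_suml unit_integral_sum; apply: eq_bigr => i _.
rewrite -{1}[q]coefK poly_def mulr_sumr unit_integral_sum; apply: eq_bigr => j _.
by rewrite -scalerAl -scalerAr -exprD !unit_integralZ unit_integralXn mulrA.
Qed.
End UnitIntegralOfProducts.

(** * The orthonormal Legendre vectors and the action of A on them *)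

Section LegendreVectors.
Context (R : realType) (H : completeNormedModType R[i]).
Context (dot : {dot H for Num.conj}) (dot_norm : inner_product_norm dot).
Context (A : {linear H -> H}) (l : R) (e : H) (l0 : 0 < l) (e1 : rnorm e = 1).
Let c : R[i] := 2 * 'i%R * l%:C.
Hypothesis dot_gram : forall k j, dot (iter k A e) (iter j A e) =
  c ^+ k * (- c) ^+ j / (k`!%:R * j`!%:R * (k + j).+1%:R).
Implicit Types (p q : {poly R}).

Let c0 : c != 0.
Proof.
apply/eqP => /(congr1 (@Im R)); rewrite /c !(Re_mul, Im_mul) /=.
by move: l0; lra.
Qed.

(* The isometry carrying [x^k] to the vector represented by [x^k] in the
   model [f |-> c * int_0^x f] on [L^2(0,1)]. *)
Definition poly_vector p : H :=
  \sum_(k < size p) ((p`_k * k`!%:R)%:C / c ^+ k) *: iter k A e.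

Lemma poly_vector_wide n p : (size p <= n)%N ->
  poly_vector p = \sum_(k < n) ((p`_k * k`!%:R)%:C / c ^+ k) *: iter k A e.
Proof.
move=> pn; rewrite /poly_vector.
rewrite (big_ord_widen n (fun k => ((p`_k * k`!%:R)%:C / c ^+ k) *: iter k A e) pn).
rewrite big_mkcond; apply: eq_bigr => i _; case: ltnP => // pi.
by rewrite nth_default// !mul0r scale0r.
Qed.

Lemma poly_vectorD p q : poly_vector (p + q) = poly_vector p + poly_vector q.
Proof.
pose n := maxn (size p) (size q).
have pn : (size p <= n)%N by exact: leq_maxl.
have qn : (size q <= n)%N by exact: leq_maxr.
rewrite !(@poly_vector_wide n) ?(leq_trans (size_polyD _ _))//.
rewrite -big_split; apply: eq_bigr => i _ /=.
by rewrite coefD mulrDl rmorphD mulrDl scalerDl.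
Qed.

Lemma poly_vectorZ (r : R) p : poly_vector (r *: p) = r%:C *: poly_vector p.
Proof.
rewrite (@poly_vector_wide (size p)) ?size_scale_leq// scaler_sumr.
by apply: eq_bigr => i _; rewrite coefZ scalerA -mulrA rmorphM !mulrA.
Qed.

Lemma poly_vectorB p q : poly_vector (p - q) = poly_vector p - poly_vector q.
Proof. by rewrite poly_vectorD -scaleN1r poly_vectorZ rmorphN1 scaleN1r. Qed.

(** In the model, c times the integral of p' from 0 to x is c p when p(0) = 0. *)
Lemma poly_vector_deriv p : p.[0] = 0 ->
  A (poly_vector p^`()) = c *: poly_vector p.
Proof.
move=> p0; rewrite (@poly_vector_wide (size p)); last first.
  by rewrite (leq_trans (size_poly _ _))// leq_pred.
rewrite (@poly_vector_wide (size p).+1 p)// big_ord_recl -horner_coef0 p0.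
rewrite !mul0r scale0r add0r linear_sum scaler_sumr; apply: eq_bigr => k _.
rewrite linearZ_LR scalerA coef_deriv /=; congr (_ *: _).
rewrite /bump add1n factS exprS -[_ *+ k.+1]mulr_natr natrM [p`_k.+1 * (_ * _)]mulrA.
have ck : c ^+ k != 0 by rewrite expf_neq0.
move: c0 ck; move: (c ^+ k) (_%:C : R[i]) (c : R[i]) => x z d d0 x0; field.
by apply/andP.
Qed.

(** The factorials and powers of c in [poly_vector] cancel those of [dot_gram], leaving 1/(i+j+1),
    the integral of x^(i+j). *)
Lemma dot_poly_vector p q :
  dot (poly_vector p) (poly_vector q) = (unit_integral (p * q))%:C.
Proof.
rewrite unit_integralM dot_suml rmorph_sum; apply: eq_bigr => i _.
rewrite dot_sumr rmorph_sum; apply: eq_bigr => j _.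
have cJ : Num.conj c = - c.
  by apply: complexP; rewrite ?Re_conjc ?Im_conjc /c /= ; ring.
have conjE (t : R) (d : R[i]) : Num.conj (t%:C / d ^+ j) = t%:C / Num.conj d ^+ j.
  by rewrite rmorphM fmorphV rmorphXn /= conj_real.
rewrite dotZl dotZr dot_gram conjE cJ.
have fact_neq0 n : n`!%:R != 0 :> R[i] by rewrite pnatr_eq0 -lt0n fact_gt0.
rewrite !rmorphM fmorphV !rmorph_nat.
have ci : c ^+ i != 0 by rewrite expf_neq0.
have cj : (- c) ^+ j != 0 by rewrite expf_neq0// oppr_eq0.
have h1 := fact_neq0 i; have h2 := fact_neq0 j.
have h3 : (i + j).+1%:R != 0 :> R[i] by rewrite pnatr_eq0.
set x : R[i] := c ^+ i in ci *; set y : R[i] := (- c) ^+ j in cj *.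
set f : R[i] := i`!%:R in h1 *; set g : R[i] := j`!%:R in h2 *.
set k : R[i] := (i + j).+1%:R in h3 *; set u : R[i] := (p`_i)%:C; set v : R[i] := (q`_j)%:C.
by move: x y f g k u v ci cj h1 h2 h3 => x y f g k u v *; field; apply/and5P.
Qed.

Let s (n : nat) : R := Num.sqrt (2 * n + 1)%:R.

Let s_gt0 n : 0 < s n.
Proof. by rewrite sqrtr_gt0 ltr0n addn1. Qed.

Let sqr_s n : s n ^+ 2 = (2 * n + 1)%:R.
Proof. by rewrite sqr_sqrtr. Qed.

(** The square root normalizes; the powers of i turn the imaginary off-diagonal coefficients of
    opposite signs into equal real ones. *)
Definition legendre_vector n : H :=
  ('i%R ^+ n * (Num.sqrt (2 * n + 1)%:R)%:C) *: poly_vector (legendre R n).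

Lemma volterra_offdiagonalS n :
  volterra_offdiagonal l n.+1 = (l / (s n * s n.+1))%:C.
Proof.
rewrite /volterra_offdiagonal /s -sqrtrM ?ler0n//.
by congr (_ / Num.sqrt (_ * _))%:C; rewrite (natrD _ (2 * _)%N 1) natrM -?natr1; ring.
Qed.

Lemma dot_legendre_vector n m :
  dot (legendre_vector n) (legendre_vector m) = (n == m)%:R.
Proof.
rewrite /legendre_vector -/(s n) -/(s m) dotZl dotZr dot_poly_vector.
have [<-|nm] := eqVneq n m; last by rewrite legendre_ortho// !mulr0.
rewrite legendre_norm mulrA mulc_conj Normc.normcM normcX normc_imaginary expr1n mul1r.
by rewrite normc_real gtr0_norm ?s_gt0// sqr_s -rmorphM mulfV// pnatr_eq0 addn1.
Qed.

Lemma legendre_vector0 : legendre_vector 0%N = e.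
Proof.
rewrite /legendre_vector legendre0 /poly_vector size_poly1 big_ord1 coef1 /=.
by rewrite !expr0 mul1r divr1 sqrtr1 !mulr1 !scale1r.
Qed.

(** The primitive of P_0 = 1 is x = (P_1 + P_0)/2; its P_0 component produces the diagonal entry
    il. *)
Lemma operator_legendre_vector0 : A (legendre_vector 0%N) =
  ('i%R * l%:C) *: legendre_vector 0%N + volterra_offdiagonal l 1%N *: legendre_vector 1%N.
Proof.
have -> : A (legendre_vector 0%N) =
    ('i%R * l%:C) *: (poly_vector (legendre R 1) + poly_vector (legendre R 0)).
  rewrite /legendre_vector expr0 mul1r sqrtr1 scale1r.
  have -> : legendre R 0 = ('X : {poly R})^`() by rewrite derivX legendre0.
  rewrite poly_vector_deriv ?hornerX// derivX.
  have X1 : 'X = 2^-1 *: (legendre R 1 + 1).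
    by rewrite legendre1 subrK -(scaler_nat 2 'X) scalerA mulVf ?scale1r.
  rewrite {1}X1 poly_vectorZ poly_vectorD scalerA; congr (_ *: _).
  rewrite /c -[2^-1%:C]/(real_complex R 2^-1) fmorphV rmorph_nat; by field.
rewrite scalerDr addrC; congr (_ + _).
  by rewrite /legendre_vector expr0 mul1r sqrtr1 scale1r.
rewrite volterra_offdiagonalS /legendre_vector expr1 -/(s 1) scalerA; congr (_ *: _).
rewrite mulrCA -rmorphM; congr (_ * _%:C).
have -> : s 0 = 1 by rewrite /s sqrtr1.
by rewrite mul1r divfK// gt_eqF.
Qed.

Lemma operator_legendre_vectorS n : A (legendre_vector n.+1) =
  volterra_offdiagonal l n.+1 *: legendre_vector n +
  volterra_offdiagonal l n.+2 *: legendre_vector n.+2.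
Proof.
have k0 : (4 * n + 6)%:R != 0 :> R by rewrite pnatr_eq0 addn_eq0 andbF.
have AP : A (poly_vector (legendre R n.+1)) = (c / (4 * n + 6)%:R) *:
    (poly_vector (legendre R n.+2) - poly_vector (legendre R n)).
  rewrite -legendre_primitive_deriv poly_vector_deriv; last first.
    by have [] := legendre_primitive_end R n.
  rewrite -poly_vectorB legendreB (poly_vectorZ (4 * n + 6)%:R) scalerA rmorph_nat divfK//.
rewrite /legendre_vector -/(s n) -/(s n.+1) -/(s n.+2) linearZ_LR AP !volterra_offdiagonalS.
rewrite !scalerA scalerBr addrC -scaleNr.
(* The factor 2 cancels the one in c, and the square of [s n.+1] leaves one such factor in the
   denominator after normalization. *)
have K4 : (4 * n + 6)%:R = 2 * (s n.+1)%:C ^+ 2 :> R[i].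
  have -> : (s n.+1)%:C ^+ 2 = (2 * n.+1 + 1)%:R :> R[i].
    by rewrite -rmorphXn /= sqr_s; exact: rmorph_nat.
  by rewrite -natrM; congr _%:R; lia.
have i2 : 'i%R ^+ 2 = -1 :> R[i] by exact: sqrCi.
rewrite K4 /c !rmorphM !fmorphV !rmorphM /= (exprSr 'i%R n.+1) (exprSr 'i%R n).
have z n' : (s n')%:C != 0 by rewrite fmorph_eq0 gt_eqF.
have := z n; have := z n.+1; have := z n.+2; move: i2.
move: ('i%R : R[i]) l%:C (s n)%:C (s n.+1)%:C (s n.+2)%:C.
move=> y L a b d y2 d0 b0 a0; congr (_ *: _ + _ *: _); last first.
  by field; apply/andP.
transitivity (- y ^+ 2 * (y ^+ n * L / b)); first by field.
by rewrite y2; field; apply/andP.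
Qed.

End LegendreVectors.

(** * Fourier expansion in a total orthonormal sequence *)

Section OrthonormalExpansion.
Context (R : realType) (H : completeNormedModType R[i]).
Context (dot : {dot H for Num.conj}) (dot_norm : inner_product_norm dot).
Context (psi : nat -> H).
Hypothesis psi_on : forall n m, dot (psi n) (psi m) = (n == m)%:R.
Hypothesis psi_total : forall x, (forall n, dot x (psi n) = 0) -> x = 0.
Implicit Types (x y : H) (a : nat -> R[i]).

Lemma dot_expansion a m n k : (m <= k < n)%N ->
  dot (\sum_(m <= j < n) a j *: psi j) (psi k) = a k.
Proof.
move=> kmn; rewrite dot_suml (bigD1_seq k) ?mem_index_iota ?iota_uniq//=.
rewrite dotZl psi_on eqxx mulr1 big1 ?addr0// => j jk.
by rewrite dotZl psi_on (negPf jk) mulr0.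
Qed.

Lemma sqr_rnorm_expansion a m n :
  rnorm (\sum_(m <= j < n) a j *: psi j) ^+ 2 = \sum_(m <= j < n) sqnormc (a j).
Proof.
apply: complexI; rewrite -(dot_rnorm dot_norm) dot_sumr rmorph_sum /=.
rewrite big_nat [RHS]big_nat; apply: eq_bigr => k kmn.
by rewrite dotZr dot_expansion// mulrC mulc_conj.
Qed.

Lemma bessel x n : \sum_(0 <= k < n) sqnormc (dot x (psi k)) <= rnorm x ^+ 2.
Proof.
pose a k := dot x (psi k); pose y := \sum_(0 <= k < n) a k *: psi k.
have xy : dot x y = (rnorm y ^+ 2)%:C.
  rewrite sqr_rnorm_expansion dot_sumr rmorph_sum; apply: eq_bigr => k _ /=.
  by rewrite dotZr mulrC mulc_conj.
have : 0 <= rnorm (x - y) ^+ 2 by exact: sqr_ge0.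
have -> : rnorm (x - y) ^+ 2 = rnorm x ^+ 2 - rnorm y ^+ 2.
  apply: complexI; rewrite -(dot_rnorm dot_norm) dotBl !dotBr (dotC dot y x) xy conj_real.
  by rewrite !(dot_rnorm dot_norm) subrr subr0 rmorphB.
by rewrite subr_ge0 sqr_rnorm_expansion.
Qed.

Lemma fourier_summable x : (fun k => dot x (psi k)) \in square_summable R.
Proof.
apply/asboolP/nondecreasing_is_cvgn.
  by apply/nondecreasing_seqP => n; rewrite seriesSr lerDl sqnormc_ge0.
by exists (rnorm x ^+ 2) => _ [n _ <-]; exact: bessel.
Qed.

Definition fourier x : ell2 R := Ell2 (fourier_summable x).

Lemma fourierE x k : fourier x k = dot x (psi k). Proof. by []. Qed.

Lemma ell2P (u v : ell2 R) : (forall k, u k = v k) -> u = v.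
Proof. by move=> uv; apply/val_inj/funext. Qed.

Lemma fourier_linear : linear fourier.
Proof. by move=> a x y; apply: ell2P => k; rewrite !fourierE dotDl dotZl. Qed.

HB.instance Definition _ :=
  GRing.isLinear.Build R[i] H (ell2 R) *:%R fourier fourier_linear.

Lemma psi_norm1 k : rnorm (psi k) = 1.
Proof.
have := dot_rnorm dot_norm (psi k); rewrite psi_on eqxx.
move/(congr1 (@Re R))/eqP => /=; rewrite eq_sym pexprn_eq1 ?rnorm_ge0//= => /eqP.
by [].
Qed.

(** Square summability makes the partial sums Cauchy. Their convergence is part of the conclusion
    because, with injectivity, it becomes the Fourier expansion of an arbitrary vector. *)
Lemma riesz_fischer (xi : ell2 R) : exists2 x, fourier x = xi &
  forall eps : R, 0 < eps -> exists N, forall n, (N <= n)%N ->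
    rnorm (x - \sum_(0 <= k < n) xi k *: psi k) <= eps.
Proof.
have cau : cauchy (series (fun k => xi k *: psi k) @ \oo).
  apply/cauchy_seriesP => eps eps0.
  (* A positive element of R[i] is real. *)
  have [epsI epsR] : Im eps = 0 /\ 0 < Re eps.
    by move: eps0; rewrite ltcE /= => /andP[/eqP].
  have epsE : eps = (Re eps)%:C by apply: complexP.
  have /cvg_cauchy/cauchy_seriesP := @ell2_is_cvg _ xi.
  move=> /(_ _ (exprn_gt0 2 epsR)).
  apply: filterS => -[m n] /= mn.
  rewrite epsE normr_rnorm ltcR -(@ltr_pXn2r _ 2) ?nnegrE ?rnorm_ge0// ?(ltW epsR)//.
  rewrite sqr_rnorm_expansion; apply: le_lt_trans mn; exact: ler_norm.
have /cauchy_cvgP/cvg_ex[x xP] := cau.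
have lim_x eps : 0 < eps -> exists N, forall n, (N <= n)%N ->
    rnorm (x - \sum_(0 <= k < n) xi k *: psi k) <= eps.
  move=> eps0; have eps0' : 0 < eps%:C by rewrite ltcR.
  move/cvgrPdist_le : xP => /(_ _ eps0')[N _ NP].
  by exists N => n /NP; rewrite normr_rnorm lecR.
exists x => //; apply: ell2P => k; rewrite fourierE.
apply/eqP; rewrite -subr_eq0; apply/eqP/Normc.eq0_normc/eqP.
rewrite eq_le normc_ge0 andbT; apply/ler_addgt0Pr => eps eps0; rewrite add0r.
have [N NP] := lim_x eps eps0.
(* The cut-off must also include the k-th term. *)
have kn : (0 <= k < maxn N k.+1)%N by rewrite leq_maxr.
have -> : dot x (psi k) - xi k =
    dot (x - \sum_(0 <= j < maxn N k.+1) xi j *: psi j) (psi k).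
  by rewrite dotBl dot_expansion.
rewrite (le_trans (normc_dot dot_norm _ _))//.
rewrite psi_norm1 mulr1 NP//; exact: leq_maxl.
Qed.

Lemma fourier_inj : injective fourier.
Proof.
move=> x y xy; apply/eqP; rewrite -subr_eq0; apply/eqP/psi_total => n.
by rewrite dotBl -!fourierE xy subrr.
Qed.

Lemma fourier_bij : bijective fourier.
Proof.
have /choice[g gP] : forall xi, exists x, fourier x = xi.
  by move=> xi; have [x] := riesz_fischer xi; exists x.
by exists g => // x; apply: fourier_inj; rewrite gP.
Qed.

Lemma fourier_expansion x eps : 0 < eps -> exists N, forall n, (N <= n)%N ->
  rnorm (x - \sum_(0 <= k < n) dot x (psi k) *: psi k) <= eps.
Proof. by have [y /fourier_inj <-] := riesz_fischer (fourier x); exact. Qed.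

Lemma fourier_isometry : isometry (@ell2_dot R) dot fourier.
Proof.
move=> x y; pose u k := fourier x k * (fourier y k)^*.
(* [complex_series] is defined componentwise; one argument for an additive f dominated by the
   modulus serves both Re and Im. *)
have lim (f : R[i] -> R) : (forall z w, f (z - w) = f z - f w) ->
    (forall z, `|f z| <= nc z) -> limn (series (fun k => f (u k))) = f (dot x y).
  move=> fB fn; apply: cvg_lim => //; apply/cvgrPdist_le => eps eps0.
  have e0 : 0 < eps / (rnorm y + 1) by rewrite divr_gt0// ltr_wpDl ?rnorm_ge0.
  have f0 : f 0 = 0 by rewrite -(subrr 0) fB subrr.
  have fN z : f (- z) = - f z by rewrite -sub0r fB f0 sub0r.
  have fD z w : f (z + w) = f z + f w by rewrite -{1}(opprK w) fB fN opprK.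
  have fsum n (F : nat -> R[i]) : \sum_(0 <= k < n) f (F k) = f (\sum_(0 <= k < n) F k).
    by elim/big_rec2: _ => // i a b _ ->; rewrite fD.
  have [N NP] := fourier_expansion x e0; exists N => // n /= Nn.
  rewrite /series /= fsum -fB.
  have -> : dot x y - \sum_(0 <= k < n) u k =
      dot (x - \sum_(0 <= k < n) dot x (psi k) *: psi k) y.
    rewrite dotBl dot_suml; congr (_ - _); apply: eq_bigr => k _.
    by rewrite dotZl (dotC dot (psi k) y).
  rewrite (le_trans (fn _))// (le_trans (normc_dot dot_norm _ _))//.
  rewrite (le_trans (ler_wpM2r (rnorm_ge0 y) (NP n Nn)))//.
  rewrite mulrAC ler_pdivrMr ?ltr_wpDl ?rnorm_ge0// ler_wpM2l ?(ltW eps0)//.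
  by rewrite lerDl.
rewrite /ell2_dot /complex_series -/(u _); apply: complexP.
  by apply: lim => [z w|z]; rewrite ?Re_add ?Re_opp ?normc_Re.
by apply: lim => [z w|z]; rewrite ?Im_add ?Im_opp ?normc_Im.
Qed.

End OrthonormalExpansion.

(** * The sesquilinear form of the rank one imaginary part *)

Section RankOneImaginaryPart.
Context (R : realType) (H : completeNormedModType R[i]).
Context (dot : {dot H for Num.conj}) (A : {linear H -> H}) (l : R) (e : H).
Hypothesis ImA : forall h, imaginary_part dot A h = (l%:C * dot h e) *: e.
Let c : R[i] := 2 * 'i%R * l%:C.

Lemma conj_c : Num.conj c = - c.
Proof. by apply: complexP; rewrite ?Re_conjc ?Im_conjc /c /= ; ring. Qed.

Let B h := A h - (c * dot h e) *: e.

Let adjointE h : adjoint dot A h = B h.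
Proof.
have i2 : 2 * 'i%R != 0 :> R[i] by rewrite mulf_neq0// neq0Ci.
have : A h - adjoint dot A h = (c * dot h e) *: e.
  apply: (scalerI (invr_neq0 i2)); rewrite -/(imaginary_part dot A h) ImA scalerA.
  by congr (_ *: _); rewrite /c -(mulrA (2 * 'i%R)) mulKf.
by rewrite /B => <-; rewrite opprB addrC subrK.
Qed.

(* [adjoint A y] is the junk value [point] at a vector [y] where no adjoint
   vector exists. As [B] is linear, this would force [B = 0], hence
   [A h = c (h, e) e], an operator that has an adjoint everywhere. *)
Lemma rank_one_imaginary_partE x y :
  dot (A x) y = dot x (A y) + c * dot x e * dot e y.
Proof.
pose Y y := exists z, forall x, dot (A x) y = dot x z.
have BY u : Y u -> forall x, dot (A x) u = dot x (B u).
  by move=> Yu; rewrite -adjointE; exact: (getPex Yu).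
have BnY u : ~ Y u -> B u = point.
  by move=> nYu; rewrite -adjointE; apply: xgetPN => z zP; apply: nYu; exists z.
suff /BY -> : Y y.
  rewrite /B dotBr dotZr rmorphM /= conj_c -(dotC dot e y); ring.
apply: contrapT => nY.
(* With neither y nor 2y in [Y], [B] equals [point] at both, and linearity forces [point] to be
   zero. *)
have nY2 : ~ Y (2 *: y).
  move=> [z zP]; apply: nY; exists (2^-1 *: z) => u.
  have c2 : Num.conj (2 : R[i]) = 2 by rewrite rmorph_nat.
  by rewrite dotZr fmorphV /= c2 -zP dotZr c2 mulKf.
have B2 : B (2 *: y) = 2 *: B y.
  by rewrite /B linearZ_LR dotZl scalerBr scalerA mulrCA.
have BD u v : B (u + v) = B u + B v.
  by rewrite /B linearD dotDl mulrDr scalerDl opprD addrACA.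
have p0 : (point : H) = 0.
  move: B2; rewrite !BnY// => /eqP; rewrite -[X in X == _]scale1r -subr_eq0 -scalerBl.
  rewrite scaler_eq0 => /orP[|/eqP//]; rewrite subr_eq0.
  by move=> /eqP/(congr1 (@Re R)) /= h; exfalso; lra.
have B0 u : B u = 0.
  have [Yu|nYu] := pselect (Y u); last by rewrite BnY.
  (* For u in [Y], u + y is outside [Y], so [B] vanishes at y and u + y and therefore at u. *)
  have : ~ Y (u + y).
    move=> [z zP]; apply: nY; exists (z - B u) => x'.
    by rewrite dotBr -zP dotDr -BY// addrC addKr.
  by move/BnY; rewrite BD (BnY _ nY) p0 addr0.
apply: nY; exists (Num.conj (c * dot e y) *: e) => u.
have /eqP := B0 u; rewrite /B subr_eq0 => /eqP ->.
by rewrite dotZl dotZr conjCK; ring.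
Qed.

End RankOneImaginaryPart.

(** * The unitary equivalence with the Jacobi operator *)

Lemma complex_series_finite (R : realType) (f : nat -> R[i]) n :
  (forall k, (n <= k)%N -> f k = 0) -> complex_series f = \sum_(0 <= k < n) f k.
Proof.
move=> f0.
have lim (g : R[i] -> R) : g 0 = 0 ->
    limn (series (fun k => g (f k))) = \sum_(0 <= k < n) g (f k).
  move=> g0; apply: lim_near_cst => //; exists n => // m /= nm.
  rewrite /series /= (big_cat_nat _ nm) //= [X in _ + X]big_nat_cond.
  by rewrite [X in _ + X]big1 ?addr0// => k /andP[/andP[nk _] _]; rewrite f0.
by apply: complexP => /=; rewrite lim// (Re_sum, Im_sum).
Qed.

Theorem theorem7p2 (R : realType) (H : completeNormedModType R[i])
    (dot : {dot H for Num.conj}) (A : {linear H -> H}) (l : R) (e : H) :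
  inner_product_norm dot ->
  separable_space H ->
  bounded_operator A ->
  prime_operator dot A ->
  dissipative dot A ->
  volterra A ->
  rank_one (imaginary_part dot A) ->
  0 < l ->
  `|e| = 1 ->
  (forall h, imaginary_part dot A h = (l%:C * dot h e) *: e) ->
  exists2 J : ell2 R -> ell2 R,
    determined_by
      (jacobi_matrix (volterra_diagonal l) (volterra_offdiagonal l)) J &
    unitarily_equivalent dot (@ell2_dot R) A J.
Proof.
move=> dot_norm _ Ab Aprime _ [_ sA] _ l0 ne ImA.
have e1 : rnorm e = 1 by rewrite /rnorm ne.
have Asym := rank_one_imaginary_partE ImA.
have [a a0 Aa] := bounded_operatorP Ab.
have [B BP] := resolvent_exists Ab sA.
have BK w : forall x, B w (x - w *: A x) = x by have [] := BP w.
have KB w : forall x, B w x - w *: A (B w x) = x by have [] := BP w.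
have Bb w : exists2 c : R, 0 <= c & forall x, rnorm (B w x) <= c * rnorm x.
  by have [] := BP w.
have G0 := logder_coef_eq0 dot_norm l0 e1 Asym a0 Aa BK KB Bb.
have gram := dot_iter_gram dot_norm e1 Asym G0.
pose psi n := legendre_vector A l e n.
have psi_on n m : dot (psi n) (psi m) = (n == m)%:R := dot_legendre_vector l0 gram n m.
have psi0 : psi 0%N = e := legendre_vector0 A l e.
have Apsi0 : A (psi 0%N) = ('i%R * l%:C) *: psi 0%N + volterra_offdiagonal l 1%N *: psi 1%N.
  exact: operator_legendre_vector0.
have ApsiS n : A (psi n.+1) = volterra_offdiagonal l n.+1 *: psi n +
    volterra_offdiagonal l n.+2 *: psi n.+2 by exact: operator_legendre_vectorS.
clearbody psi.
have psi_total x : (forall n, dot x (psi n) = 0) -> x = 0.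
  (* [M] is invariant by the three-term relations, and A is symmetric on it because e = psi 0 is
     orthogonal to [M]; hence [M] reduces A and primeness applies. *)
  pose M := [set x | forall n, dot x (psi n) = 0].
  suff M0 : M = [set 0] by move=> xM; have : M x by []; rewrite M0.
  have Me u : M u -> dot u e = 0 by move/(_ 0%N); rewrite psi0.
  have Me' u : M u -> dot e u = 0 by move=> Mu; rewrite dotC Me// conjC0.
  have MA u : M u -> M (A u).
    move=> Mu n; rewrite Asym (Me _ Mu) mulr0 mul0r addr0.
    by case: n => [|n]; rewrite ?Apsi0 ?ApsiS dotDr !dotZr !Mu !mulr0 addr0.
  apply: Aprime.
    split=> //; first split.
    - move=> u Mu n; apply/Normc.eq0_normc/eqP.
      rewrite eq_le normc_ge0 andbT; apply/ler_addgt0Pr => eps eps0; rewrite add0r.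
      have eps0' : 0 < eps%:C by rewrite ltcR.
      have [v [Mv]] := Mu _ (nbhsx_ballx u _ eps0').
      rewrite -ball_normE /= normr_rnorm ltcR => uv.
      have -> : dot u (psi n) = dot (u - v) (psi n) by rewrite dotBl Mv subr0.
      rewrite (le_trans (normc_dot dot_norm _ _))// (psi_norm1 dot_norm psi_on) mulr1.
      exact: ltW.
    - by move=> n; rewrite dot0l.
    - by move=> b u v Mu Mv n; rewrite dotDl dotZl Mu Mv mulr0 addr0.
    - move=> u uM v Mv; rewrite Asym (Me' _ Mv) mulr0 addr0; exact/uM/MA.
  by move=> u v Mu Mv; rewrite Asym (Me _ Mu) mulr0 mul0r addr0.
have [g gK Kg] := fourier_bij dot_norm psi_on psi_total.
(* J is A transported by the Fourier map; what then remains is to compute its matrix. *)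
exists (fun xi => fourier dot_norm psi_on (A (g xi))); last first.
  exists (fourier dot_norm psi_on); split; first exact: fourier_bij.
    exact: fourier_isometry.
  by move=> u; rewrite gK.
move=> xi i; rewrite -{2}(Kg xi); move: (g xi) => u.
rewrite fourierE Asym.
have off_conj n : Num.conj (volterra_offdiagonal l n) = volterra_offdiagonal l n.
  exact: conj_real.
(* Row i of the matrix is zero from column i + 2 on. *)
rewrite (@complex_series_finite _ _ i.+2) => [|k ik]; last first.
  rewrite /jacobi_matrix ltn_eqF 1?ltnW// gtn_eqF// ltn_eqF ?mul0r//.
  by rewrite ltnS ltnW// ltnW.
case: i => [|n].
  (* Conjugation turns the coefficient il into -il, and the rank one term c = 2il of [Asym] restores
     il. *)
  rewrite !big_nat_recr ?big_geq//= Apsi0 dotDr !dotZr off_conj.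
  rewrite /jacobi_matrix /= -psi0 psi_on /= rmorphM /= conj_real conjCi.
  rewrite /volterra_diagonal /=. ring.
rewrite -psi0 psi_on /= mulr0 addr0 ApsiS dotDr !dotZr !off_conj.
rewrite !big_nat_recr //= big_nat_cond big1 => [|k /andP[/andP[_ kn] _]]; last first.
  rewrite /jacobi_matrix gtn_eqF; last by rewrite ltnS ltnW.
  by rewrite ltn_eqF ?gtn_eqF ?mul0r// !ltnS // ltnW// ltnW.
rewrite /jacobi_matrix !eqxx gtn_eqF// ltn_eqF// /volterra_diagonal /= ltn_eqF//.
ring.
Qed.
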